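(* Let $\mathcal P$ be a locally trivial quantum principal fibre bundle whose Hopf algebra $H$ has bijective antipode $S$. Left gauge transformations $\alpha_l$ on $\mathcal P$ are in one-to-one correspondence with linear maps $g_{\alpha_l}:H\to\mathcal P$ satisfying $$g_{\alpha_l}(1)=1,\qquad \Delta_{\mathcal P}(g_{\alpha_l}(h))=\sum g_{\alpha_l}(h_2)\otimes S(h_1)h_3,$$ for which there is a linear map $g_{\alpha_l^{-1}}:H\to\mathcal P$ with $$\sum g_{\alpha_l}(h_1)g_{\alpha_l^{-1}}(h_2)=\sum g_{\alpha_l^{-1}}(h_1)g_{\alpha_l}(h_2)=\varepsilon(h)1\quad\forall h\in H.$$ The correspondence is given by $\alpha_l(f)=\sum f_0\,g_{\alpha_l}(f_1)$, $f\in\mathcal P$. Right gauge transformations $\alpha_r$ on $\mathcal P$ are in one-to-one correspondence with linear maps $g_{\alpha_r}:H\to\mathcal P$ satisfying $$g_{\alpha_r}(1)=1,\qquad \Delta_{\mathcal P}(g_{\alpha_r}(h))=\sum g_{\alpha_r}(h_2)\otimes h_3S^{-1}(h_1),$$ for which there is a linear map $g_{\alpha_r^{-1}}:H\to\mathcal P$ with $$\sum g_{\alpha_r}(h_2)g_{\alpha_r^{-1}}(h_1)=\sum g_{\alpha_r^{-1}}(h_2)g_{\alpha_r}(h_1)=\varepsilon(h)1\quad\forall h\in H.$$ The correspondence is given by $\alpha_r(f)=\sum g_{\alpha_r}(f_1)f_0$, $f\in\mathcal P$. In both cases $g_{\alpha_{l,r}^{-1}}$ is the map corresponding to the inverse gauge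 transformation $\alpha_{l,r}^{-1}$.
   Context: Algebras are unital and associative over $\mathbb C$. Sweedler notation: $\Delta(h)=\sum h_1\otimes h_2$, $\Delta_{\mathcal P}(f)=\sum f_0\otimes f_1$. A covering of an algebra $B$ is a finite family $(J_i)_{i\in I}$ of two-sided ideals with $\bigcap_i J_i=0$; put $B_i=B/J_i$, $B_{ij}=B/(J_i+J_j)$, with quotient maps $\pi_i:B\to B_i$, $\pi^i_j:B_i\to B_{ij}$. The covering is complete if $b\mapsto(\pi_i(b))_i$ maps $B$ onto $\{(b_i)\in\bigoplus_i B_i\mid \pi^i_j(b_i)=\pi^j_i(b_j)\ \forall i,j\}$. A locally trivial quantum principal fibre bundle (QPFB) consists of an algebra $B$ with complete covering $(J_i)_{i\in I}$, a Hopf algebra $H$, a right $H$-comodule algebra $\mathcal P$ with coaction $\Delta_{\mathcal P}:\mathcal P\to\mathcal P\otimes H$, an injective homomorphism $\iota:B\to\mathcal P$, and surjective homomorphisms (local trivializations) $\chi_i:\mathcal P\to B_i\otimes H$ such that $\chi_i(\iota(b))=\pi_i(b)\otimes 1$, $(\chi_i\otimes id)\circ\Delta_{\mathcal P}=(id\otimes\Delta)\circ\chi_i$, and $(\ker\chi_i)_{i\in I}$ is a complete covering of $\mathcal P$. There are then transition isomorphisms $\phi_{ij}:B_{ij}\otimes H\to B_{ij}\otimes H$ with $(\pi^i_j\otimes id)\circ\chi_i=\phi_{ij}\circ(\pi^j_i\otimes id)\circ\chi_j$. A left (right) gauge transformation on $B_i\otimes H$ is an isomorphism $\alpha$ of left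 (right) $(B_i\otimes 1)$-modules of $B_i\otimes H$ with $(\alpha\otimes id)\circ(id\otimes\Delta)=(id\otimes\Delta)\circ\alpha$ and $\alpha(a\otimes1)=a\otimes 1$ for $a\in B_i$. A left (right) gauge transformation on $\mathcal P$ is an isomorphism $\alpha_{l}$ ($\alpha_r$) $:\mathcal P\to\mathcal P$ of left (right) $\iota(B)$-modules such that there is a family of left (right) gauge transformations $\alpha_{l,r_i}$ on $B_i\otimes H$ with $\chi_i\circ\alpha_{l,r}=\alpha_{l,r_i}\circ\chi_i$ for all $i$. The inverse of a gauge transformation is again one. *)

(* Defs.v *)
From HB Require Import structures.
From mathcomp Require Import all_boot all_algebra generic_quotient ring_quotient.
From mathcomp Require Import boolp classical_sets functions reals.
From mathcomp.real_closed Require Import complex.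
From mathcomp.finmap Require Import finmap.
From mathcomp.multinomials Require Import monalg.

Set Implicit Arguments.
Unset Strict Implicit.
Unset Printing Implicit Defensive.

Import GRing.Theory.
Local Open Scope ring_scope.
Local Open Scope quotient_scope.

(* Unital associative algebras.  The library's [algType] excludes the zero
   algebra, but quotients such as B / (J_i + J_j) may vanish; and the library's
   hierarchy does not accept a new join of [lmodType] and [pzRingType], hence
   the separate names for the product and the unit. *)
HB.mixin Record Lmodule_isUAlgebra (K : pzRingType) A of GRing.Lmodule K A := {
  aone : A;
  amul : A -> A -> A;
  amulA : associative amul;
  amul1l : left_id aone amul;
  amul1r : right_id aone amul;
  amul_linearl : forall y, linear (amul^~ y);
  amul_linearr : forall x, linear (amul x)
}.

#[short(type="ualgType")]
HB.structure Definition UAlgebra (K : pzRingType) :=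
  {A of GRing.Lmodule K A & Lmodule_isUAlgebra K A}.

Notation "x ** y" := (amul x y) (at level 40, left associativity) : ring_scope.
Notation "\1" := aone : ring_scope.

Definition alg_hom (K : fieldType) (A B : ualgType K) (f : A -> B) : Prop :=
  [/\ linear f, f \1 = \1 & {morph f : x y / x ** y}].

Record submod (K : fieldType) (V : lmodType K) := Submod {
  submod_set :> V -> Prop;
  submod_mem0 : submod_set 0;
  submod_memP : forall (a : K) u v,
    submod_set u -> submod_set v -> submod_set (a *: u + v)
}.

Section QuotientModule.
Variables (K : fieldType) (V : lmodType K) (S : submod V).

Definition submod_pred : {pred V} := fun v => `[< S v >].

Lemma submod_zmod_closed : zmod_closed submod_pred.
Proof.
split; first by apply/asboolP; exact: submod_mem0.
move=> u v /asboolP Su /asboolP Sv; apply/asboolP.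
by rewrite addrC -scaleN1r; exact: submod_memP.
Qed.
HB.instance Definition _ :=
  GRing.isZmodClosed.Build V submod_pred submod_zmod_closed.

Definition quotm := (Quotient.quot submod_pred).
HB.instance Definition _ := GRing.Zmodule.on quotm.

Definition qpi (v : V) : quotm := \pi_(Quotient.quot submod_pred) v.

Definition qrepr (x : quotm) : V := repr (x : (Quotient.quot submod_pred)).

Lemma qreprK x : qpi (qrepr x) = x. Proof. exact: reprK. Qed.

Lemma qpiP u v : qpi u = qpi v <-> S (u - v).
Proof.
split=> [/eqP|Suv]; first by rewrite -Quotient.idealrBE => /asboolP.
by apply/eqP; rewrite -Quotient.idealrBE; apply/asboolP.
Qed.

Lemma qpi0 : qpi 0 = 0.
Proof. by rewrite /qpi !piE. Qed.

Lemma qpiD : {morph qpi : u v / u + v}.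
Proof. by move=> u v; rewrite /qpi !piE. Qed.

Definition quotm_scale (a : K) (x : quotm) : quotm := qpi (a *: qrepr x).

Lemma qpi_scale a v : quotm_scale a (qpi v) = qpi (a *: v).
Proof.
apply/qpiP; rewrite -scalerBr -[_ *: _]addr0.
apply: submod_memP; last exact: submod_mem0.
by apply/qpiP; rewrite qreprK.
Qed.

Lemma quotm_scaleA a b x :
  quotm_scale a (quotm_scale b x) = quotm_scale (a * b) x.
Proof. by rewrite -[x]qreprK !qpi_scale scalerA. Qed.
Lemma quotm_scale1 : left_id 1 quotm_scale.
Proof. by move=> x; rewrite -[x]qreprK qpi_scale scale1r. Qed.
Lemma quotm_scaleDr : right_distributive quotm_scale +%R.
Proof.
move=> a x y; rewrite -[x]qreprK -[y]qreprK -qpiD !qpi_scale -qpiD.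
by rewrite scalerDr.
Qed.
Lemma quotm_scaleDl x : {morph quotm_scale^~ x : a b / a + b}.
Proof.
by move=> a b; rewrite -[x]qreprK !qpi_scale -qpiD scalerDl.
Qed.
HB.instance Definition _ := GRing.Zmodule_isLmodule.Build K quotm
  quotm_scaleA quotm_scale1 quotm_scaleDr quotm_scaleDl.

Lemma qpi_linear : linear qpi.
Proof. by move=> a u v; rewrite qpiD -[in LHS]qpi_scale. Qed.

End QuotientModule.

Section Span.
Variables (K : fieldType) (V : lmodType K) (X : set V).

Definition span_set (v : V) : Prop :=
  forall S : submod V, (forall x, X x -> S x) -> S v.

Lemma span_mem0 : span_set 0.
Proof. by move=> S _; exact: submod_mem0. Qed.

Lemma span_memP (a : K) u v :
  span_set u -> span_set v -> span_set (a *: u + v).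
Proof.
by move=> Su Sv S XS; apply: submod_memP; [exact: Su|exact: Sv].
Qed.

Definition span : submod V := Submod span_mem0 span_memP.

End Span.

Definition bilin (K : fieldType) (V W U : lmodType K) (f : V -> W -> U) : Prop :=
  (forall w, linear (f^~ w)) /\ (forall v, linear (f v)).

Section Tensor.
Variables (K : fieldType) (V W : lmodType K).

Local Notation free := {malg K[(V * W)%type]}.

Definition tensor_rel : set free := [set x |
  (exists (a : K) (v v' : V) (w : W),
     x = << (a *: v + v', w) >> - (a *: << (v, w) >> + << (v', w) >>)) \/
  (exists (a : K) (v : V) (w w' : W),
     x = << (v, a *: w + w') >> - (a *: << (v, w) >> + << (v, w') >>))].

Definition tensor := quotm (span tensor_rel).
HB.instance Definition _ := GRing.Lmodule.on tensor.

Definition tens (v : V) (w : W) : tensor :=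
  qpi (span tensor_rel) << (v, w) >>.

(* The map on the tensor product induced by f, computed on a representative;
   it is meaningful for bilinear f only (see [tliftE], [tlift_linear]).
   In Sweedler notation, [tlift F (Delta h)] is \sum F(h_1, h_2). *)
Definition tlift (U : lmodType K) (f : V -> W -> U) (t : tensor) : U :=
  let g := qrepr (t : quotm (span tensor_rel)) in
  \sum_(p <- msupp g) g@_p *: f p.1 p.2.

Lemma tens_bilin : bilin tens.
Proof.
split=> [w a v v'|v a w w']; rewrite /tens -[RHS]qpi_linear; apply/qpiP => S; apply.
  by left; exists a, v, v', w.
by right; exists a, v, w, w'.
Qed.

Section Lift.
Variables (U : lmodType K) (f : V -> W -> U).

Definition free_lift (g : free) : U := \sum_(p <- msupp g) g@_p *: f p.1 p.2.

Lemma free_liftEw (d : {fset (V * W)%type}) (g : free) : (msupp g `<=` d)%fset ->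
  free_lift g = \sum_(p <- d) g@_p *: f p.1 p.2.
Proof.
move=> le; rewrite /free_lift (big_fset_incl _ le) => //= x xd /mcoeff_outdom ->.
by rewrite scale0r.
Qed.

Lemma free_liftU v w : free_lift << (v, w) >> = f v w.
Proof. by rewrite (free_liftEw msuppU_le) big_seq_fset1 mcoeffUU scale1r. Qed.

Lemma free_lift_linear : linear free_lift.
Proof.
move=> a g1 g2.
pose d := (msupp g1 `|` msupp g2)%fset.
rewrite (@free_liftEw d (a *: g1 + g2)); last first.
  by apply: (fsubset_trans (msuppD_le _ _)); apply: fsetSU; exact: msuppZ_le.
rewrite (@free_liftEw d g1) ?fsubsetUl // (@free_liftEw d g2) ?fsubsetUr //.
rewrite scaler_sumr -big_split /=; apply: eq_bigr => p _.
by rewrite mcoeffD mcoeffZ scalerDl scalerA.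
Qed.

Hypothesis f_bilin : bilin f.

Lemma free_lift_ker0 : free_lift 0 = 0.
Proof. by rewrite /free_lift msupp0 big_seq_fset0. Qed.

Lemma free_lift_kerP a u v :
  free_lift u = 0 -> free_lift v = 0 -> free_lift (a *: u + v) = 0.
Proof. by move=> u0 v0; rewrite free_lift_linear u0 v0 scaler0 addr0. Qed.

Definition free_lift_ker : submod free := Submod free_lift_ker0 free_lift_kerP.

Lemma tlift_pi (g : free) : tlift f (qpi (span tensor_rel) g) = free_lift g.
Proof.
pose g' := qrepr (qpi (span tensor_rel) g).
have: span tensor_rel (g' - g) by apply/qpiP; rewrite qreprK.
have lB x y : free_lift (x - y) = free_lift x - free_lift y.
  by rewrite [x - y]addrC -(scaleN1r y) free_lift_linear scaleN1r addrC.
move=> /(_ free_lift_ker) /= H; apply/eqP; rewrite -subr_eq0.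
rewrite -[tlift _ _]/(free_lift g') -lB; apply/eqP; apply: H.
move=> x [[a [v [v' [w ->]]]]|[a [v [w [w' ->]]]]];
  rewrite lB free_lift_linear !free_liftU.
  by rewrite f_bilin.1 subrr.
by rewrite f_bilin.2 subrr.
Qed.

Lemma tlift_linear : linear (tlift f).
Proof.
move=> a s t; rewrite -[s]qreprK -[t]qreprK.
by rewrite -[_ *: _ + _]qpi_linear !tlift_pi free_lift_linear.
Qed.

Lemma tliftE v w : tlift f (tens v w) = f v w.
Proof. by rewrite tlift_pi free_liftU. Qed.

End Lift.

Lemma tensor_ind (Q : tensor -> Prop) : Q 0 ->
  (forall a v w t, Q t -> Q (a *: tens v w + t)) -> forall t, Q t.
Proof.
move=> Q0 QS t; rewrite -[t]qreprK (monalgE (qrepr t)).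
elim: (enum_fset (msupp (qrepr t))) => [|p s IH]; first by rewrite big_nil qpi0.
rewrite big_cons.
have -> : << (qrepr t)@_p *g p >> = (qrepr t)@_p *: << (p.1, p.2) >> :> free.
  by apply/malgP => k; rewrite mcoeffZ !mcoeffU; case: p => v w; rewrite mulr_natr.
by rewrite qpi_linear; exact: QS.
Qed.

Lemma tlift_ext (U : lmodType K) (f g : V -> W -> U) t :
  (forall v w, f v w = g v w) -> tlift f t = tlift g t.
Proof. by move=> fg; apply: eq_bigr => p _; rewrite fg. Qed.

Lemma tlift_linear_fun (U : lmodType K) a (f g : V -> W -> U) t :
  tlift (fun v w => a *: f v w + g v w) t = a *: tlift f t + tlift g t.
Proof.
rewrite /tlift scaler_sumr -big_split /=; apply: eq_bigr => p _.
by rewrite scalerDr !scalerA mulrC.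
Qed.

Lemma tensor_linear_ext (U : lmodType K) (f g : tensor -> U) :
  linear f -> linear g -> (forall v w, f (tens v w) = g (tens v w)) -> f =1 g.
Proof.
move=> lf lg fg; have l0 (h : tensor -> U) : linear h -> h 0 = 0.
  by move=> lh; have := lh (-1) 0 0; rewrite scaler0 addr0 scaleN1r addNr.
elim/tensor_ind => [|a v w t IH]; first by rewrite !l0.
by rewrite lf lg fg IH.
Qed.

End Tensor.

Arguments tens {K V W}.

Notation "v ⊗ w" := (tens v w) (at level 40, left associativity) : ring_scope.

Section TensorAlgebra.
Variables (K : fieldType) (A B : ualgType K).

Definition tensor_mul (s t : tensor A B) : tensor A B :=
  tlift (fun a b => tlift (fun a' b' => (a ** a') ⊗ (b ** b')) t) s.

Let inner_bilin (a : A) (b : B) :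
  bilin (fun a' b' => (a ** a') ⊗ (b ** b')).
Proof.
split=> [b' k x y|a' k x y] /=.
  by rewrite amul_linearr (tens_bilin _ _).1.
by rewrite amul_linearr (tens_bilin _ _).2.
Qed.

Let outer_bilin (t : tensor A B) :
  bilin (fun a b => tlift (fun a' b' => (a ** a') ⊗ (b ** b')) t).
Proof.
split=> [b k x y|a k x y] /=; rewrite -tlift_linear_fun;
  apply: tlift_ext => a' b'; rewrite amul_linearl.
  by rewrite (tens_bilin _ _).1.
by rewrite (tens_bilin _ _).2.
Qed.

Lemma tensor_mulE a b a' b' :
  tensor_mul (a ⊗ b) (a' ⊗ b') = (a ** a') ⊗ (b ** b').
Proof. by rewrite /tensor_mul !tliftE. Qed.

Lemma tensor_mul_linearl t : linear (tensor_mul^~ t).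
Proof. exact: tlift_linear. Qed.

Lemma tensor_mul_linearr s : linear (tensor_mul s).
Proof.
move=> k t t'; rewrite /tensor_mul -tlift_linear_fun.
by apply: tlift_ext => a b; rewrite tlift_linear.
Qed.

Lemma tensor_mulA : associative tensor_mul.
Proof.
move=> s t u.
apply: (tensor_linear_ext
  (f := fun s => tensor_mul s (tensor_mul t u))
  (g := fun s => tensor_mul (tensor_mul s t) u)) s => [||a b].
- exact: tensor_mul_linearl.
- by move=> k x y; rewrite !tensor_mul_linearl.
apply: (tensor_linear_ext
  (f := fun t => tensor_mul (a ⊗ b) (tensor_mul t u))
  (g := fun t => tensor_mul (tensor_mul (a ⊗ b) t) u)) t => [||a' b'].
- by move=> k x y; rewrite tensor_mul_linearl tensor_mul_linearr.
- by move=> k x y; rewrite tensor_mul_linearr tensor_mul_linearl.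
apply: (tensor_linear_ext
  (f := fun u => tensor_mul (a ⊗ b) (tensor_mul (a' ⊗ b') u))
  (g := tensor_mul (tensor_mul (a ⊗ b) (a' ⊗ b')))) u => [||a'' b''].
- by move=> k x y; rewrite !tensor_mul_linearr.
- exact: tensor_mul_linearr.
by rewrite !tensor_mulE !amulA.
Qed.

Lemma tensor_mul1l : left_id (\1 ⊗ \1) tensor_mul.
Proof.
apply: tensor_linear_ext => [||a b]; first exact: tensor_mul_linearr.
  by [].
by rewrite tensor_mulE !amul1l.
Qed.

Lemma tensor_mul1r : right_id (\1 ⊗ \1) tensor_mul.
Proof.
apply: tensor_linear_ext => [||a b]; first exact: tensor_mul_linearl.
  by [].
by rewrite tensor_mulE !amul1r.
Qed.

HB.instance Definition _ := Lmodule_isUAlgebra.Build K (tensor A B)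
  tensor_mulA tensor_mul1l tensor_mul1r tensor_mul_linearl tensor_mul_linearr.

End TensorAlgebra.

Definition tmap (K : fieldType) (V W V' W' : lmodType K)
    (f : V -> V') (g : W -> W') : tensor V W -> tensor V' W' :=
  tlift (fun v w => f v ⊗ g w).

(* The canonical isomorphism V ⊗ (W ⊗ U) -> (V ⊗ W) ⊗ U. *)
Definition tassoc (K : fieldType) (V W U : lmodType K) :
    tensor V (tensor W U) -> tensor (tensor V W) U :=
  tlift (fun v => tlift (fun w u => (v ⊗ w) ⊗ u)).

Record ideal (K : fieldType) (A : ualgType K) := Ideal {
  ideal_submod :> submod A;
  ideal_mulP : forall a x b, ideal_submod x -> ideal_submod (a ** x ** b)
}.

Section QuotientAlgebra.
Variables (K : fieldType) (A : ualgType K) (J : ideal A).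

Definition quota : Type := quotm J.
HB.instance Definition _ := GRing.Lmodule.on quota.

Definition quota_mul (x y : quota) : quota := qpi J (qrepr x ** qrepr y).

Lemma qpi_mul a b : quota_mul (qpi J a) (qpi J b) = qpi J (a ** b).
Proof.
have sub (x : A) : J (qrepr (qpi J x) - x) by apply/qpiP; rewrite qreprK.
apply/qpiP; set a' := qrepr _; set b' := qrepr _.
have -> : a' ** b' - a ** b = 1 *: (\1 ** (a' - a) ** b') + (a ** (b' - b) ** \1).
  rewrite amul1l amul1r [a' - a]addrC [b' - b]addrC -(scaleN1r a) -(scaleN1r b).
  rewrite amul_linearl amul_linearr scale1r !scaleN1r.
  by rewrite [- _ + a' ** b']addrC [- _ + a ** b']addrC addrA subrK.
by apply: submod_memP; apply: ideal_mulP; apply: sub.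
Qed.

Lemma quota_mulA : associative quota_mul.
Proof.
move=> x y z; rewrite -[x]qreprK -[y]qreprK -[z]qreprK.
by rewrite !qpi_mul amulA.
Qed.
Lemma quota_mul1l : left_id (qpi J \1) quota_mul.
Proof. by move=> x; rewrite -[x]qreprK qpi_mul amul1l. Qed.
Lemma quota_mul1r : right_id (qpi J \1) quota_mul.
Proof. by move=> x; rewrite -[x]qreprK qpi_mul amul1r. Qed.
Lemma quota_mul_linearl y : linear (quota_mul^~ y).
Proof.
move=> k x x'; rewrite -[x]qreprK -[x']qreprK -[y]qreprK.
by rewrite -[_ *: _ + _]qpi_linear !qpi_mul amul_linearl [LHS]qpi_linear.
Qed.
Lemma quota_mul_linearr x : linear (quota_mul x).
Proof.
move=> k y y'; rewrite -[x]qreprK -[y]qreprK -[y']qreprK.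
by rewrite -[_ *: _ + _]qpi_linear !qpi_mul amul_linearr [LHS]qpi_linear.
Qed.

HB.instance Definition _ := Lmodule_isUAlgebra.Build K quota
  quota_mulA quota_mul1l quota_mul1r quota_mul_linearl quota_mul_linearr.

Definition aproj (a : A) : quota := qpi J a.

End QuotientAlgebra.

(* The map A / J -> A / J', meaningful when J is contained in J'. *)
Definition quota_map (K : fieldType) (A : ualgType K) (J J' : ideal A)
    (x : quota J) : quota J' := aproj J' (qrepr x).

Section IdealConstructions.
Variables (K : fieldType) (A B : ualgType K).

Section Sum.
Variables (J J' : ideal A).

Definition ideal_sum_set (x : A) : Prop :=
  exists y z, [/\ J y, J' z & x = y + z].

Lemma ideal_sum_mem0 : ideal_sum_set 0.
Proof.
by exists 0, 0; split; rewrite ?addr0 //; exact: submod_mem0.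
Qed.
Lemma ideal_sum_memP (k : K) u v :
  ideal_sum_set u -> ideal_sum_set v -> ideal_sum_set (k *: u + v).
Proof.
move=> [y [z [Jy Jz ->]]] [y' [z' [Jy' Jz' ->]]].
exists (k *: y + y'), (k *: z + z'); split; try exact: submod_memP.
by rewrite scalerDr addrACA.
Qed.
Lemma ideal_sum_mulP a x b :
  Submod ideal_sum_mem0 ideal_sum_memP x ->
  Submod ideal_sum_mem0 ideal_sum_memP (a ** x ** b).
Proof.
move=> [y [z [Jy Jz ->]]]; exists (a ** y ** b), (a ** z ** b).
split; try exact: ideal_mulP.
by rewrite -[y in LHS]scale1r amul_linearr amul_linearl scale1r.
Qed.

Definition ideal_sum : ideal A := Ideal ideal_sum_mulP.

End Sum.

Section Kernel.
Variables (f : A -> B) (f_hom : alg_hom f).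

Lemma ker_mem0 : f 0 = 0.
Proof.
case: f_hom => lf _ _; have := lf (-1) 0 0.
by rewrite scaler0 addr0 scaleN1r addNr.
Qed.
Lemma ker_memP (k : K) u v : f u = 0 -> f v = 0 -> f (k *: u + v) = 0.
Proof.
by case: f_hom => lf _ _ u0 v0; rewrite lf u0 v0 scaler0 addr0.
Qed.
Lemma ker_mulP a x b :
  Submod ker_mem0 ker_memP x -> Submod ker_mem0 ker_memP (a ** x ** b).
Proof.
case: f_hom => _ _ fM /= x0; rewrite !fM x0.
have mul0r y : amul y 0 = 0 :> B.
  by have := amul_linearr y (-1) 0 0; rewrite scaler0 addr0 scaleN1r addNr.
have mul0l y : amul 0 y = 0 :> B.
  by have := amul_linearl y (-1) 0 0; rewrite scaler0 addr0 scaleN1r addNr.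
by rewrite mul0r mul0l.
Qed.

Definition ker_ideal : ideal A := Ideal ker_mulP.

End Kernel.
End IdealConstructions.

Definition covering (K : fieldType) (A : ualgType K) (I : finType)
    (J : I -> ideal A) : Prop :=
  forall a, (forall i, J i a) -> a = 0.

Definition complete_covering (K : fieldType) (A : ualgType K) (I : finType)
    (J : I -> ideal A) : Prop :=
  covering J /\
  forall a : forall i, quota (J i),
    (forall i j, quota_map (ideal_sum (J i) (J j)) (a i) =
                 quota_map (ideal_sum (J i) (J j)) (a j)) ->
    exists a0 : A, forall i, aproj (J i) a0 = a i.

Record hopf (K : fieldType) (H : ualgType K) := Hopf {
  comul : H -> tensor H H;
  counit : H -> K;
  antipode : H -> H;
  comul_hom : alg_hom comul;
  counit_hom :
    [/\ scalar counit, counit \1 = 1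
       & {morph counit : x y / x ** y >-> (x * y)%R}];
  comulA : forall h, tmap comul id (comul h) = tassoc (tmap id comul (comul h));
  counitl : forall h, tlift (fun h1 h2 => counit h1 *: h2) (comul h) = h;
  counitr : forall h, tlift (fun h1 h2 => counit h2 *: h1) (comul h) = h;
  antipode_linear : linear antipode;
  antipodel : forall h,
    tlift (fun h1 h2 => antipode h1 ** h2) (comul h) = counit h *: \1;
  antipoder : forall h,
    tlift (fun h1 h2 => h1 ** antipode h2) (comul h) = counit h *: \1
}.

Section Bundles.
Variables (K : fieldType) (H : ualgType K) (hH : hopf H).

(* [sweedler3 F h] is \sum F(h_1, h_2, h_3), for F trilinear. *)
Definition sweedler3 (U : lmodType K) (F : H -> H -> H -> U) (h : H) : U :=
  tlift (fun h1 h' => tlift (fun h2 h3 => F h1 h2 h3) (comul hH h')) (comul hH h).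

(* id ⊗ Delta, as a map A ⊗ H -> (A ⊗ H) ⊗ H. *)
Definition trivial_coaction (A : ualgType K) (x : tensor A H) :
    tensor (tensor A H) H :=
  tassoc (tmap id (comul hH) x).

Definition comodule_algebra (P : ualgType K) (coact : P -> tensor P H) : Prop :=
  [/\ alg_hom coact,
      forall f, tmap coact id (coact f) = tassoc (tmap id (comul hH) (coact f))
    & forall f, tlift (fun f0 f1 => counit hH f1 *: f0) (coact f) = f].

Section Local.
Variable A : ualgType K.
Implicit Type alpha : tensor A H -> tensor A H.

Definition local_gauge alpha : Prop :=
  [/\ linear alpha, bijective alpha,
      forall x, tmap alpha id (trivial_coaction x) = trivial_coaction (alpha x)
    & forall a, alpha (a ⊗ \1) = a ⊗ \1].

Definition local_left_gauge alpha : Prop :=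
  local_gauge alpha /\ forall a x, alpha ((a ⊗ \1) ** x) = (a ⊗ \1) ** alpha x.

Definition local_right_gauge alpha : Prop :=
  local_gauge alpha /\ forall a x, alpha (x ** (a ⊗ \1)) = alpha x ** (a ⊗ \1).

End Local.

Record qpfb (I : finType) (B P : ualgType K) := QPFB {
  base_ideal : I -> ideal B;
  coaction : P -> tensor P H;
  iota : B -> P;
  chi : forall i, P -> tensor (quota (base_ideal i)) H;
  base_complete : complete_covering base_ideal;
  coaction_comodule : comodule_algebra coaction;
  iota_hom : alg_hom iota;
  iota_inj : injective iota;
  chi_hom : forall i, alg_hom (@chi i);
  chi_surj : forall i y, exists f, chi i f = y;
  chi_iota : forall i b, chi i (iota b) = aproj (base_ideal i) b ⊗ \1;
  chi_colinear : forall i f,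
    tmap (@chi i) id (coaction f) = trivial_coaction (chi i f);
  chi_complete : complete_covering (fun i => ker_ideal (chi_hom i))
}.

Variables (I : finType) (B P : ualgType K) (E : qpfb I B P).

(* [K]-linearity is automatic for isomorphisms of unital modules over [iota B]. *)
Definition left_gauge (alpha : P -> P) : Prop :=
  [/\ linear alpha, bijective alpha,
      forall b f, alpha (iota E b ** f) = iota E b ** alpha f
    & exists alpha_ : forall i,
          tensor (quota (base_ideal E i)) H -> tensor (quota (base_ideal E i)) H,
        forall i, local_left_gauge (alpha_ i) /\
          forall f, chi E i (alpha f) = alpha_ i (chi E i f)].

Definition right_gauge (alpha : P -> P) : Prop :=
  [/\ linear alpha, bijective alpha,
      forall b f, alpha (f ** iota E b) = alpha f ** iota E b
    & exists alpha_ : forall i,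
          tensor (quota (base_ideal E i)) H -> tensor (quota (base_ideal E i)) H,
        forall i, local_right_gauge (alpha_ i) /\
          forall f, chi E i (alpha f) = alpha_ i (chi E i f)].

Definition conv_inverse (g g' : H -> P) : Prop :=
  forall h,
    tlift (fun h1 h2 => g h1 ** g' h2) (comul hH h) = counit hH h *: \1 /\
    tlift (fun h1 h2 => g' h1 ** g h2) (comul hH h) = counit hH h *: \1.

Definition conv_inverse_op (g g' : H -> P) : Prop :=
  forall h,
    tlift (fun h1 h2 => g h2 ** g' h1) (comul hH h) = counit hH h *: \1 /\
    tlift (fun h1 h2 => g' h2 ** g h1) (comul hH h) = counit hH h *: \1.

Definition left_gauge_map (g : H -> P) : Prop :=
  [/\ linear g, g \1 = \1,
      forall h, coaction E (g h) =
        sweedler3 (fun h1 h2 h3 => g h2 ⊗ (antipode hH h1 ** h3)) h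
    & exists g' : H -> P, linear g' /\ conv_inverse g g'].

(* [Sinv] is the inverse of the antipode. *)
Definition right_gauge_map (Sinv : H -> H) (g : H -> P) : Prop :=
  [/\ linear g, g \1 = \1,
      forall h, coaction E (g h) =
        sweedler3 (fun h1 h2 h3 => g h2 ⊗ (h3 ** Sinv h1)) h
    & exists g' : H -> P, linear g' /\ conv_inverse_op g g'].

Definition left_gauge_of (g : H -> P) (f : P) : P :=
  tlift (fun f0 f1 => f0 ** g f1) (coaction E f).

Definition right_gauge_of (g : H -> P) (f : P) : P :=
  tlift (fun f0 f1 => g f1 ** f0) (coaction E f).

End Bundles.

(* Main.v *)
Require Import Defs.
From HB Require Import structures.
From mathcomp Require Import all_boot all_algebra.
From mathcomp Require Import boolp classical_sets functions reals.
From mathcomp.real_closed Require Import complex.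

(** For linear u : X -> A on a right H-comodule X and g : H -> A, put
    (u * g)(x) = \sum u(x_0) g(x_1); then (u * g) * g' = u * (g * g'), where the
    product on the right is the convolution.  With i p = p ⊗ 1 and j h = 1 ⊗ h, the
    coaction of P is i * j, covariance of g reads
    Delta_P \o g = (j S) * (i g) * j, and the gauge transformation attached to g
    is id * g; so colinearity and invertibility of id * g follow from
    j * (j S) = 1.  Conversely, on B_i ⊗ H, where k h = 1 ⊗ h is a colinear
    algebra map, alpha_i = id * g_i with g_i = (k S) * (alpha_i k).  The g_i h glue:
    if pi : P -> P / (ker chi_i + ker chi_j) factors as q chi_i, then
    pi alpha = pi * w determines w, because q k is convolution invertible, while
    the images w of both g_i and g_j solve this equation.  Right gauge
    transformations are left ones for the opposite algebras, H^op having antipode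
    S^-1. *)

Set Implicit Arguments.
Unset Strict Implicit.
Unset Printing Implicit Defensive.

Import GRing.Theory.

Local Open Scope ring_scope.
Local Open Scope classical_set_scope.

(** * Linear maps on tensor products *)

Section Tensors.
Variable K : fieldType.

Lemma linear_tlift (V W U U' : lmodType K) (f : {linear U -> U'})
    (F : V -> W -> U) t : f (tlift F t) = tlift (fun v w => f (F v w)) t.
Proof. by rewrite /tlift linear_sum; apply: eq_bigr => p _; rewrite linearZ. Qed.

HB.instance Definition _ (A : ualgType K) (x : A) :=
  GRing.isLinear.Build K A A *:%R (amul x) (amul_linearr x).

Lemma amul_tliftr (V W : lmodType K) (A : ualgType K) (x : A) (F : V -> W -> A) t :
  x ** tlift F t = tlift (fun v w => x ** F v w) t.
Proof. exact: (linear_tlift (amul x)). Qed.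

Definition amulr (A : ualgType K) (y x : A) := x ** y.
HB.instance Definition _ (A : ualgType K) (y : A) :=
  GRing.isLinear.Build K A A *:%R (amulr y) (amul_linearl y).

Lemma amul_tliftl (V W : lmodType K) (A : ualgType K) (x : A) (F : V -> W -> A) t :
  tlift F t ** x = tlift (fun v w => F v w ** x) t.
Proof. exact: (linear_tlift (amulr x)). Qed.

Lemma amulZr (A : ualgType K) a (x y : A) : x ** (a *: y) = a *: (x ** y).
Proof. exact: linearZ_LR (amul x) a y. Qed.

Lemma amulZl (A : ualgType K) a (x y : A) : (a *: x) ** y = a *: (x ** y).
Proof. exact: linearZ_LR (amulr y) a x. Qed.

Lemma bilin_mul (V W : lmodType K) (A : ualgType K) (u : {linear V -> A})
    (g : {linear W -> A}) : bilin (fun v w => u v ** g w).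
Proof.
by split=> [w|v] a x y; rewrite linearP ?amul_linearl ?amul_linearr.
Qed.

Lemma bilin_tens (V W V' W' : lmodType K) (f : {linear V -> V'})
    (g : {linear W -> W'}) : bilin (fun v w => f v ⊗ g w).
Proof.
by split=> [w|v] a x y; rewrite linearP ?(tens_bilin _ _).1 ?(tens_bilin _ _).2.
Qed.

HB.instance Definition _ (V W V' W' : lmodType K) (f : {linear V -> V'})
    (g : {linear W -> W'}) :=
  GRing.isLinear.Build K (tensor V W) (tensor V' W') *:%R (tmap f g)
    (tlift_linear (bilin_tens f g)).

Lemma tmapE (V W V' W' : lmodType K) (f : {linear V -> V'})
    (g : {linear W -> W'}) v w : tmap f g (v ⊗ w) = f v ⊗ g w.
Proof. exact: tliftE (bilin_tens f g) v w. Qed.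

Lemma tlift_tmap (V W V' W' U : lmodType K) (f : {linear V -> V'})
    (g : {linear W -> W'}) (F : V' -> W' -> U) t : bilin F ->
  tlift F (tmap f g t) = tlift (fun v w => F (f v) (g w)) t.
Proof.
move=> bF.
have lF : linear (tlift F) by exact: tlift_linear.
pose L : {linear _ -> _} := HB.pack (tlift F) (GRing.isLinear.Build _ _ _ _ _ lF).
rewrite -[LHS]/(L _) (linear_tlift L); apply: tlift_ext => v w.
exact: tliftE.
Qed.

Lemma tmap_tlift (V W U U' X : lmodType K) (f : {linear U -> U'})
    (F : V -> W -> tensor U X) t :
  tmap f id (tlift F t) = tlift (fun v w => tmap f id (F v w)) t.
Proof. exact: (linear_tlift (tmap f idfun)). Qed.

Lemma eq_tensor (V W U : lmodType K) (f g : {linear tensor V W -> U}) :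
  (forall v w, f (v ⊗ w) = g (v ⊗ w)) -> f =1 g.
Proof. by move=> fg; apply: tensor_linear_ext => //; exact: linearP. Qed.

End Tensors.

(** * Functionals separate the elements of a tensor product *)

Section Separation.
Variable K : fieldType.

Lemma submodD (V : lmodType K) (S : submod V) u v : S u -> S v -> S (u + v).
Proof. by move=> Su Sv; rewrite -[u]scale1r; exact: submod_memP. Qed.

Lemma submodZ (V : lmodType K) (S : submod V) a u : S u -> S (a *: u).
Proof.
move=> Su; rewrite -[_ *: _]addr0.
by apply: submod_memP => //; exact: submod_mem0.
Qed.

Lemma submodB (V : lmodType K) (S : submod V) u v : S u -> S v -> S (u - v).
Proof. by move=> Su Sv; apply: submodD => //; rewrite -scaleN1r; exact: submodZ. Qed.

Lemma maximal_submod_avoiding (V : lmodType K) (S : submod V) (v : V) : ~ S v ->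
  exists M : submod V, [/\ forall u, S u -> M u, ~ M v &
    forall w, ~ M w -> exists a m, M m /\ v = a *: w + m].
Proof.
move=> nSv.
pose closed (T : set V) := forall a u w, T u -> T w -> T (a *: u + w).
(* Only the union of [S] and [T] is required to be closed: the empty chain has empty union, which is
   then admissible for Zorn. *)
have [F FP Ftot|T [[clT nTv] maxT]] :=
    @Zorn_bigcup V (fun T => closed ([set u | S u] `|` T) /\ ~ T v).
  split; last by move=> [X /FP[_ nXv]].
  move=> a u w [Su|[X FX Xu]] [Sw|[Y FY Yw]].
  - by left; exact: submod_memP.
  - have [cl _] := FP _ FY.
    by case: (cl a u w) => //; [left|right|left|right; exists Y].
  - have [cl _] := FP _ FX.
    by case: (cl a u w) => //; [right|left|left|right; exists X].
  - have [XY|YX] := Ftot _ _ FX FY.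
      have [cl _] := FP _ FY.
      by case: (cl a u w); [right; exact: XY|right|left|right; exists Y].
    have [cl _] := FP _ FX.
    by case: (cl a u w); [right|right; exact: YX|left|right; exists X].
pose M := Submod (or_introl (submod_mem0 S)) clT : submod V.
exists M; split=> [u Su||w nMw]; [by left|by case=> // /nSv|].
apply: contrapT => nvw.
(* [B] is [M] plus the line through [w]; if it avoided [v], it would contradict the maximality of
   [T]. *)
pose B := [set x | exists a m, M m /\ x = a *: w + m].
apply: (maxT B).
  split=> [u Tu|BT].
    by exists 0, u; split; [right|rewrite scale0r add0r].
  apply: nMw; right; apply: BT; exists 1, 0; split; first exact: submod_mem0.
  by rewrite scale1r addr0.
split=> [a x y|//].
have SB : forall x, S x -> B x.
  by move=> z Sz; exists 0, z; split; [left|rewrite scale0r add0r].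
move=> Bx By; have {Bx} [b [m [Mm ->]]] : B x by case: Bx => // /SB.
have {By} [c [m' [Mm' ->]]] : B y by case: By => // /SB.
right; exists (a * b + c), (a *: m + m'); split; first exact: submod_memP.
by rewrite scalerDr scalerDl scalerA addrACA.
Qed.

(** With [M] maximal containing [S] and avoiding [v], each [w] is congruent modulo [M] to a unique
    multiple of [v], whose coefficient is [phi w]. *)
Lemma separating_functional (V : lmodType K) (S : submod V) (v : V) : ~ S v ->
  exists phi : {scalar V}, phi v = 1 /\ forall u, S u -> phi u = 0.
Proof.
move=> /maximal_submod_avoiding[M [SM nMv Mmax]].
have ex w : exists c, M (w - c *: v).
  have [Mw|/Mmax[a [m [Mm Ev]]]] := pselect (M w).
    by exists 0; rewrite scale0r subr0.
  have a0 : a != 0.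
    by apply: contra_notN nMv => /eqP a0; rewrite Ev a0 scale0r add0r.
  exists a^-1; rewrite Ev scalerDr scalerA mulVf // scale1r opprD addrA subrr sub0r.
  by rewrite -scaleN1r; do 2 apply: submodZ.
have uniq w c c' : M (w - c *: v) -> M (w - c' *: v) -> c = c'.
  move=> Mc Mc'; apply/eqP; rewrite -subr_eq0; apply: contra_notT nMv => c0.
  rewrite -[v](scalerK c0); apply: submodZ.
  have -> : (c - c') *: v = (w - c' *: v) - (w - c *: v).
    by rewrite opprB [RHS]addrC addrA subrK scalerBl.
  exact: submodB.
pose f w := sval (cid (ex w)).
have fP w : M (w - f w *: v) := svalP (cid (ex w)).
have lf : scalar f.
  move=> a x y; apply: (uniq (a *: x + y)) => //.
  have -> : a *: x + y - (a * f x + f y) *: v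
      = a *: (x - f x *: v) + (y - f y *: v).
    by rewrite scalerDl scalerBr scalerA opprD addrACA.
  exact: submod_memP.
pose phi : {scalar V} := HB.pack f (GRing.isLinear.Build _ _ _ _ _ lf).
exists phi; split=> [|u /SM Mu]; apply: uniq (fP _) _.
  by rewrite scale1r subrr; exact: submod_mem0.
by rewrite scale0r subr0.
Qed.

Lemma tens0l (V W : lmodType K) (w : W) : 0 ⊗ w = 0 :> tensor V W.
Proof.
have /= := (tens_bilin V W).1 w (-1) 0 0.
by rewrite scaler0 addr0 scaleN1r addNr.
Qed.

Lemma tens_zl (V W : lmodType K) a (v : V) (w : W) : (a *: v) ⊗ w = a *: (v ⊗ w).
Proof.
by have /= := (tens_bilin V W).1 w a v 0; rewrite addr0 tens0l addr0.
Qed.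

Lemma tens_sum (V W : lmodType K) (t : tensor V W) :
  exists n (v : nat -> V) (w : nat -> W), t = \sum_(i < n) v i ⊗ w i.
Proof.
elim/tensor_ind: t => [|a v w t [n [f [g ->]]]].
  by exists 0%N, (fun=> 0), (fun=> 0); rewrite big_ord0.
exists n.+1, (fun i => if i is j.+1 then f j else a *: v).
exists (fun i => if i is j.+1 then g j else w).
by rewrite big_ord_recl /= tens_zl.
Qed.

Definition contract (V W : lmodType K) (phi : W -> K) : tensor V W -> V :=
  tlift (fun v w => phi w *: v).

Lemma bilin_contract (V W : lmodType K) (phi : {scalar W}) :
  bilin (fun (v : V) w => phi w *: v).
Proof.
split=> [w|v] a x y; first by rewrite scalerDr !scalerA mulrC.
by rewrite linearP scalerDl scalerA.
Qed.

HB.instance Definition _ (V W : lmodType K) (phi : {scalar W}) :=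
  GRing.isLinear.Build K (tensor V W) V *:%R (@contract V W phi)
    (tlift_linear (bilin_contract V phi)).

Lemma contractE (V W : lmodType K) (phi : {scalar W}) (v : V) w :
  contract phi (v ⊗ w) = phi w *: v.
Proof. exact: tliftE (bilin_contract V phi) v w. Qed.

(** Induction on the number of terms of [t]. If the last right factor lies outside the span of the
    others, a functional separates it and its left factor vanishes; otherwise the last term is
    absorbed into the others. *)
Lemma tensor_separated (V W : lmodType K) (t : tensor V W) :
  (forall phi : {scalar W}, contract phi t = 0) -> t = 0.
Proof.
have [n [f [g ->]]] := tens_sum t.
move=> s0; have {s0}: forall phi : {scalar W},
    \sum_(i < n) phi (g i) *: f i = 0.
  move=> phi; rewrite -[RHS](s0 phi).
  rewrite -[RHS]/(contract phi _) linear_sum; apply: eq_bigr => i _.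
  by rewrite /= contractE.
elim: n f g => [f g _|n IH f g s0]; first by rewrite big_ord0.
have [gn|ngn] := pselect (Defs.span [set g (val i) | i in [set: 'I_n]] (g n)); last first.
  have [phi [phi1 phi0]] := separating_functional ngn.
  have f0 : f n = 0.
    have := s0 phi; rewrite big_ord_recr /= phi1 scale1r big1 ?add0r // => i _.
    by rewrite phi0 ?scale0r // => S; apply; exists i.
  rewrite big_ord_recr /= f0 tens0l addr0; apply: IH => psi.
  by have := s0 psi; rewrite big_ord_recr /= f0 scaler0 addr0.
(* Such [x] form a submodule containing every [g i] with i < n, hence also [g n]. *)
pose rewritable x := forall v, exists h : 'I_n -> V,
  v ⊗ x = \sum_(i < n) h i ⊗ g i.
have rw0 : rewritable 0.
  move=> v; exists (fun=> 0); rewrite big1 => [|i _]; last exact: tens0l.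
  have /= := (tens_bilin V W).2 v (-1) 0 0.
  by rewrite scaler0 addr0 scaleN1r addNr.
have rwP a x y : rewritable x -> rewritable y -> rewritable (a *: x + y).
  move=> rx ry v; have [h hE] := rx v; have [h' h'E] := ry v.
  exists (fun i => a *: h i + h' i); rewrite (tens_bilin V W).2 hE h'E.
  by rewrite scaler_sumr -big_split; apply: eq_bigr => i _; rewrite (tens_bilin V W).1.
have [|h hE] := gn (Submod rw0 rwP) _ (f n).
  move=> _ [i _ <-] v; exists (fun j => if j == i then v else 0).
  by rewrite (bigD1 i) //= eqxx big1 ?addr0 // => j /negPf ->; exact: tens0l.
(* [h] is indexed by ordinals, [f'] by naturals; the default 0 concerns indices from [n] on, which
   are not summed. *)
pose f' k := f k + (if insub k is Some i then h i else 0).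
have f'E (i : 'I_n) : f' i = f i + h i by rewrite /f' valK.
have E : \sum_(i < n.+1) f i ⊗ g i = \sum_(i < n) f' i ⊗ g i.
  rewrite big_ord_recr /= hE -big_split; apply: eq_bigr => i _.
  rewrite f'E -[f i in RHS]scale1r (tens_bilin V W).1 scale1r //.
rewrite E; apply: IH => psi; have := s0 psi.
have LE m (u : nat -> V) :
    \sum_(i < m) psi (g i) *: u i = contract psi (\sum_(i < m) u i ⊗ g i).
  by rewrite linear_sum; apply: eq_bigr => i _; rewrite /= contractE.
by rewrite !LE E.
Qed.

(** Contracting the second factor commutes with [f j], which reduces the claim to elements of [V].
    This will carry covariance from the charts back to the total algebra. *)
Lemma tmap_jointly_injective (J : Type) (V W : lmodType K) (U : J -> lmodType K)
    (f : forall j, {linear V -> U j}) :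
  (forall v, (forall j, f j v = 0) -> v = 0) ->
  forall t t' : tensor V W,
  (forall j, tmap (f j) idfun t = tmap (f j) idfun t') -> t = t'.
Proof.
move=> f_inj t t' tt'; apply/eqP; rewrite -subr_eq0; apply/eqP.
apply: tensor_separated => phi; apply: f_inj => j.
have -> : f j (contract phi (t - t')) = contract phi (tmap (f j) idfun (t - t')).
  rewrite /contract linear_tlift tlift_tmap; last exact: bilin_contract.
  by apply: tlift_ext => v w; rewrite linearZ.
by rewrite [tmap _ _ _]linearB /= tt' subrr linear0.
Qed.

End Separation.

(** * Convolution *)

Section MulMap.
Variable K : fieldType.

(** Kept apart from the coaction, so that naturality and associativity can be stated on arbitrary
    tensors. *)
Definition mulmap (X Y : lmodType K) (A : ualgType K) (u : X -> A) (g : Y -> A) :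
  tensor X Y -> A := tlift (fun x y => u x ** g y).

HB.instance Definition _ (X Y : lmodType K) (A : ualgType K)
    (u : {linear X -> A}) (g : {linear Y -> A}) :=
  GRing.isLinear.Build K (tensor X Y) A *:%R (mulmap u g)
    (tlift_linear (bilin_mul u g)).

Lemma mulmapE (X Y : lmodType K) (A : ualgType K)
    (u : {linear X -> A}) (g : {linear Y -> A}) x y : mulmap u g (x ⊗ y) = u x ** g y.
Proof. exact: tliftE (bilin_mul u g) x y. Qed.

Lemma mulmap_tmap (X Y X' Y' : lmodType K) (A : ualgType K)
    (u : {linear X' -> A}) (g : {linear Y' -> A})
    (f : {linear X -> X'}) (f' : {linear Y -> Y'}) t :
  mulmap u g (tmap f f' t) = mulmap (u \o f) (g \o f') t.
Proof. exact: tlift_tmap (bilin_mul u g). Qed.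

Lemma bilin_tassoc (V W U : lmodType K) :
  bilin (fun (v : V) => tlift (fun (w : W) (u : U) => (v ⊗ w) ⊗ u)).
Proof.
split=> [t|v] a x y /=.
  rewrite -tlift_linear_fun; apply: tlift_ext => w u.
  by rewrite (tens_bilin _ _).1 (tens_bilin _ _).1.
rewrite [LHS]tlift_linear //; split=> [u|w] b z z' /=.
  by rewrite (tens_bilin _ _).2 (tens_bilin _ _).1.
by rewrite (tens_bilin _ _).2.
Qed.

HB.instance Definition _ (V W U : lmodType K) :=
  GRing.isLinear.Build K (tensor V (tensor W U)) (tensor (tensor V W) U) *:%R
    (@tassoc K V W U) (tlift_linear (@bilin_tassoc V W U)).

Lemma tassocE (V W U : lmodType K) (v : V) (w : W) (u : U) :
  tassoc (v ⊗ (w ⊗ u)) = (v ⊗ w) ⊗ u.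
Proof.
rewrite /tassoc (tliftE (@bilin_tassoc V W U)) tliftE //.
split=> [y|x] b z z' /=.
  by rewrite (tens_bilin _ _).2 (tens_bilin _ _).1.
by rewrite (tens_bilin _ _).2.
Qed.

Lemma eq_tensor3 (V W U X : lmodType K) (f g : {linear tensor V (tensor W U) -> X}) :
  (forall v w u, f (v ⊗ (w ⊗ u)) = g (v ⊗ (w ⊗ u))) -> f =1 g.
Proof.
move=> fg; apply: eq_tensor => v.
have lv (h : {linear tensor V (tensor W U) -> X}) : linear (fun t => h (v ⊗ t)).
  by move=> a x y; rewrite (tens_bilin _ _).2 linearP.
by apply: tensor_linear_ext => // w u; exact: fg.
Qed.

Lemma mulmap_tassoc (X Y Z : lmodType K) (A : ualgType K)
    (u : {linear X -> A}) (v : {linear Y -> A}) (w : {linear Z -> A}) t :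
  mulmap (mulmap u v) w (tassoc t) = mulmap u (mulmap v w) t.
Proof.
move: t; apply: (eq_tensor3 (f := mulmap (mulmap u v) w \o @tassoc K X Y Z)
                            (g := mulmap u (mulmap v w))) => x y z.
by rewrite /= tassocE !mulmapE /= !mulmapE amulA.
Qed.

End MulMap.

Section Comodules.
Variables (K : fieldType) (H : ualgType K) (hH : hopf H).

Record comodule (X : lmodType K) := Comodule {
  coact :> X -> tensor X H;
  coact_linear : linear coact;
  coactA : forall x,
    tmap coact id (coact x) = tassoc (tmap id (comul hH) (coact x));
  coact_counit : forall x, tlift (fun x0 x1 => counit hH x1 *: x0) (coact x) = x
}.

HB.instance Definition _ (X : lmodType K) (c : comodule X) :=
  GRing.isLinear.Build K X (tensor X H) *:%R (coact c) (coact_linear c).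

Lemma comul_linear : linear (comul hH).
Proof. by case: (comul_hom hH). Qed.
Lemma counit_scalar : scalar (counit hH).
Proof. by case: (counit_hom hH). Qed.

HB.instance Definition _ :=
  GRing.isLinear.Build K H (tensor H H) *:%R (comul hH) comul_linear.
HB.instance Definition _ :=
  GRing.isLinear.Build K H K *%R (counit hH) counit_scalar.
HB.instance Definition _ :=
  GRing.isLinear.Build K H H *:%R (antipode hH) (antipode_linear hH).

Definition regular : comodule H :=
  Comodule comul_linear (comulA hH) (counitr hH).

End Comodules.

(* Locked because unification would otherwise unfold convolutions down to the
   quotient construction of the tensor product. *)
HB.lock Definition conv (K : fieldType) (H : ualgType K) (hH : hopf H)
    (X : lmodType K) (A : ualgType K) (c : comodule hH X)
    (u : X -> A) (g : H -> A) : X -> A :=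
  fun x => tlift (fun x0 x1 => u x0 ** g x1) (c x).

Section Convolution.
Variables (K : fieldType) (H : ualgType K) (hH : hopf H).
Local Notation comodule := (comodule hH).
Local Notation regular := (regular hH).

Lemma convE (X : lmodType K) (A : ualgType K) (c : comodule X)
    (u : X -> A) (g : H -> A) : conv c u g = mulmap u g \o c.
Proof. by rewrite unlock. Qed.

Lemma conv_linear (X : lmodType K) (A : ualgType K) (c : comodule X)
    (u : {linear X -> A}) (g : {linear H -> A}) : linear (conv c u g).
Proof. rewrite convE; exact: linearP (mulmap u g \o c). Qed.

HB.instance Definition _ (X : lmodType K) (A : ualgType K) (c : comodule X)
    (u : {linear X -> A}) (g : {linear H -> A}) :=
  GRing.isLinear.Build K X A *:%R (conv c u g) (conv_linear c u g).

(** The neutral element of convolution. *)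
Definition cunit (A : ualgType K) : H -> A := fun h => counit hH h *: \1.

Lemma cunit_linear A : linear (@cunit A).
Proof. by move=> a x y; rewrite /cunit linearP scalerDl scalerA. Qed.

HB.instance Definition _ (A : ualgType K) :=
  GRing.isLinear.Build K H A *:%R (@cunit A) (@cunit_linear A).

Section Laws.
Variables (X : lmodType K) (A : ualgType K) (c : comodule X).
Implicit Types (u : {linear X -> A}) (g : {linear H -> A}).

(** Coassociativity of [c] rebrackets the tensor, associativity of [A] the product. *)
Lemma convA u g g' : conv c (conv c u g) g' = conv c u (conv regular g g').
Proof.
apply/funext => x; rewrite /= !convE /= -(mulmap_tmap _ _ c idfun).
by rewrite [tmap _ _ _]coactA mulmap_tassoc (mulmap_tmap _ _ idfun (comul hH)).
Qed.

Lemma convu1 u : conv c u (@cunit A) = u.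
Proof.
apply/funext => x; rewrite /= !convE /= -[in RHS](coact_counit c x) linear_tlift.
by apply: tlift_ext => x0 x1; rewrite /cunit amulZr amul1r linearZ.
Qed.

Lemma conv1g g : conv regular (@cunit A) g = g.
Proof.
apply/funext => h; rewrite /= !convE /= -[in RHS](counitl hH h) linear_tlift.
by apply: tlift_ext => h0 h1; rewrite /cunit amulZl amul1l linearZ.
Qed.

End Laws.

Lemma conv_comp (X : lmodType K) (A B : ualgType K) (c : comodule X) (f : {linear A -> B})
    (u : X -> A) (g : H -> A) : {morph f : x y / x ** y} ->
  f \o conv c u g = conv c (f \o u) (f \o g).
Proof.
move=> fM; apply/funext => x; rewrite /= !convE /= linear_tlift.
by apply: tlift_ext => y z; rewrite fM.
Qed.

Definition colinear (X Y : lmodType K) (c : comodule X) (d : comodule Y) (f : X -> Y) :=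
  forall x, tmap f id (c x) = d (f x).

Lemma conv_colinear (X Y : lmodType K) (A : ualgType K) (c : comodule X)
    (d : comodule Y) (f : {linear X -> Y}) (u : {linear Y -> A}) (g : {linear H -> A}) :
  colinear c d f -> conv d u g \o f = conv c (u \o f) g.
Proof.
by move=> fc; apply/funext => x; rewrite /= !convE /= -fc (mulmap_tmap _ _ f idfun).
Qed.

Lemma conv_cancel (A : ualgType K) (v u w w' : {linear H -> A}) :
  conv regular v u = @cunit A -> conv regular u w = conv regular u w' ->
  w =1 w'.
Proof.
move=> vu uw h; rewrite -[w h]/((w : H -> A) h) -(conv1g w) -(conv1g w') -vu.
by rewrite !convA uw.
Qed.

(** The monoid argument v = v * (u * w) = (v * u) * w = w. Formulas below are proved by exhibiting
    both sides as inverses of one map. *)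
Lemma conv_inverse_uniq (A : ualgType K) (v u w : {linear H -> A}) :
  conv regular v u = @cunit A -> conv regular u w = @cunit A -> v =1 w.
Proof.
by move=> vu uw h; rewrite -(convu1 regular v) -uw -convA vu conv1g.
Qed.

Lemma conv_antipodel : conv regular (antipode hH) idfun = @cunit H.
Proof. by apply/funext => h; rewrite convE; exact: antipodel. Qed.

Lemma conv_antipoder : conv regular idfun (antipode hH) = @cunit H.
Proof. by apply/funext => h; rewrite convE; exact: antipoder. Qed.

End Convolution.

Section Embeddings.
Variables (K : fieldType) (A B : ualgType K).

Lemma amul_tens (a a' : A) (b b' : B) :
  (a ⊗ b) ** (a' ⊗ b') = (a ** a') ⊗ (b ** b').
Proof. exact: tensor_mulE. Qed.

Definition tensl (a : A) : tensor A B := a ⊗ \1.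
Definition tensr (b : B) : tensor A B := \1 ⊗ b.

HB.instance Definition _ :=
  GRing.isLinear.Build K A (tensor A B) *:%R tensl ((tens_bilin A B).1 \1).
HB.instance Definition _ :=
  GRing.isLinear.Build K B (tensor A B) *:%R tensr ((tens_bilin A B).2 \1).

Lemma tenslM : {morph tensl : x y / x ** y}.
Proof. by move=> x y; rewrite /tensl amul_tens amul1l. Qed.
Lemma tensrM : {morph tensr : x y / x ** y}.
Proof. by move=> x y; rewrite /tensr amul_tens amul1l. Qed.
Lemma tens_lr a b : a ⊗ b = tensl a ** tensr b.
Proof. by rewrite amul_tens amul1l amul1r. Qed.

Lemma tmap_id (V W : lmodType K) (t : tensor V W) : tmap id id t = t.
Proof.
move: t; apply: (eq_tensor (f := tmap idfun idfun) (g := idfun)) => v w.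
exact: (tmapE idfun idfun).
Qed.

End Embeddings.

(** * Covariant maps into comodule algebras *)

Section CovariantMaps.
Variables (K : fieldType) (H : ualgType K) (hH : hopf H).
Let S := antipode hH.
Let reg := regular hH.

Lemma comp_cunit (A B : ualgType K) (f : {linear A -> B}) : f \1 = \1 ->
  f \o @cunit K H hH A = @cunit K H hH B.
Proof. by move=> f1; apply/funext => h; rewrite /= /cunit linearZ f1. Qed.

Section HomAntipode.
Variables (A : ualgType K) (k : {linear H -> A}).
Hypotheses (k1 : k \1 = \1) (kM : {morph k : x y / x ** y}).

(** An algebra map carries S * id = epsilon to its target, so [k \o S] is the convolution inverse of
    [k]. Applied below to j, c k, i k, q k and [k] itself. *)
Lemma conv_hom_antipodel : conv reg (k \o S) k = @cunit K H hH A.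
Proof. by rewrite -(comp_cunit k1) -conv_antipodel conv_comp. Qed.
Lemma conv_hom_antipoder : conv reg k (k \o S) = @cunit K H hH A.
Proof. by rewrite -(comp_cunit k1) -conv_antipoder conv_comp. Qed.

End HomAntipode.

Section ComoduleAlgebra.
Variables (P : ualgType K) (c : comodule hH P).
Hypotheses (c1 : c \1 = \1) (cM : {morph c : x y / x ** y}).
Local Notation i := (@tensl K P H).
Local Notation j := (@tensr K P H).
Local Notation cunit A := (@cunit K H hH A).

Lemma tmap_coactE (X : lmodType K) (d : comodule hH X) (u : X -> P) :
  tmap u id \o d = conv d (i \o u) j.
Proof.
by rewrite convE; apply/funext => x; apply: tlift_ext => x0 x1; exact: tens_lr.
Qed.

Lemma coact_conv : conv c i j = c.
Proof.
apply/funext => f; rewrite -[RHS]tmap_id.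
exact: esym (congr1 (fun u => u f) (tmap_coactE c id)).
Qed.

Lemma tensr_antipodel : conv reg (j \o S) j = cunit (tensor P H).
Proof. exact: conv_hom_antipodel (@tensrM K P H). Qed.
Lemma tensr_antipoder : conv reg j (j \o S) = cunit (tensor P H).
Proof. exact: conv_hom_antipoder (@tensrM K P H). Qed.

Definition covariant (g : H -> P) :=
  c \o g = conv reg (j \o S) (conv reg (i \o g) j).

Lemma covariantP (g : H -> P) : covariant g <->
  forall h, c (g h) = sweedler3 hH (fun h1 h2 h3 => g h2 ⊗ (S h1 ** h3)) h.
Proof.
have E h : conv reg (j \o S) (conv reg (i \o g) j) h =
    sweedler3 hH (fun h1 h2 h3 => g h2 ⊗ (S h1 ** h3)) h.
  rewrite !convE; apply: tlift_ext => h1 h' /=.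
  rewrite amul_tliftr; apply: tlift_ext => h2 h3.
  by rewrite /= !amul_tens !amul1l amul1r.
split=> [cg h|cg]; first by rewrite -E -cg.
by apply/funext => h; rewrite E -cg.
Qed.

(** Both sides equal i * (i g) * j: the left one because i is multiplicative, the right one because
    c = i * j and covariance produces a factor j * (j S) that cancels. *)
Lemma twist_colinear (g : {linear H -> P}) : covariant g ->
  colinear c c (conv c idfun g).
Proof.
move=> cg; rewrite /colinear => f.
rewrite -[LHS]/((tmap _ id \o c) f) -[RHS]/((c \o conv c idfun g) f).
congr (_ f); rewrite tmap_coactE (conv_comp _ _ _ (@tenslM K P H)) convA.
have -> : c \o conv c idfun g = conv c (conv c i j) (c \o g).
  by rewrite coact_conv; exact: conv_comp.
by rewrite cg convA -(convA reg) tensr_antipoder conv1g.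
Qed.

(** c g' is a left and (j S) * (i g') * j a right convolution inverse of c g, so the two
    coincide. *)
Lemma covariant_inv (g g' : {linear H -> P}) : covariant g ->
  conv reg g g' = cunit P -> conv reg g' g = cunit P -> covariant g'.
Proof.
move=> cg gg' g'g; apply/funext.
have linv : conv reg (c \o g') (c \o g) = cunit (tensor P H).
  by rewrite -(conv_comp _ _ _ cM) g'g comp_cunit.
suff rinv : conv reg (c \o g) (conv reg (j \o S) (conv reg (i \o g') j)) =
    cunit (tensor P H) by exact: conv_inverse_uniq linv rinv.
rewrite cg convA convA -(convA _ j) tensr_antipoder conv1g -(convA _ (i \o g)).
rewrite -(conv_comp _ _ _ (@tenslM K P H)) gg' comp_cunit // conv1g.
exact: tensr_antipodel.
Qed.

(** By colinearity of id * g, the map id * g' composed with it is (id * g) * g' = id * (g * g'). *)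
Lemma twistK (g g' : {linear H -> P}) : covariant g ->
  conv reg g g' = cunit P -> cancel (conv c idfun g) (conv c idfun g').
Proof.
move=> cg gg' f; rewrite -[LHS]/((conv c idfun g' \o conv c idfun g) f).
rewrite (conv_colinear idfun g' (twist_colinear cg)).
by rewrite -[idfun \o _]/(conv c idfun g) convA gg' convu1.
Qed.

Section Cleft.
Variables (k : {linear H -> P}).
Hypotheses (k1 : k \1 = \1) (kM : {morph k : x y / x ** y}).
Hypothesis k_colinear : colinear reg c k.

(* The trivial comodule algebra is cleft by k; this recovers g from id * g. *)
Definition cleft_map (alpha : P -> P) : H -> P :=
  conv reg (k \o S) (alpha \o k).

(** Colinearity of [k] means c k = (i k) * j; the two sides are its left and right convolution
    inverses. *)
Lemma coact_cleft_antipode : c \o k \o S = conv reg (j \o S) (i \o k \o S).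
Proof.
have linv : conv reg (c \o k \o S) (c \o k) = cunit (tensor P H).
  apply: (conv_hom_antipodel (k := c \o k)) => [|x y] /=; first by rewrite k1.
  by rewrite kM cM.
suff rinv : conv reg (c \o k) (conv reg (j \o S) (i \o k \o S)) =
    cunit (tensor P H) by apply/funext; exact: conv_inverse_uniq linv rinv.
have -> : c \o k = conv reg (i \o k) j.
  by rewrite -(tmap_coactE reg k); apply/funext => h; rewrite /= -k_colinear.
rewrite convA -(convA reg j) tensr_antipoder conv1g.
apply: (conv_hom_antipoder (k := i \o k)) => [|x y] /=; first by rewrite k1.
by rewrite kM tenslM.
Qed.

(** Here c alpha k = (i alpha k) * j, so c of the cleft map is (j S) * (i k S) * (i alpha k) * j,
    whose two middle factors make up i of the cleft map. *)
Lemma cleft_covariant (alpha : {linear P -> P}) :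
  colinear c c alpha -> covariant (cleft_map alpha).
Proof.
move=> ca; rewrite /covariant /cleft_map (conv_comp _ _ _ cM).
rewrite -[c \o (k \o S)]/(c \o k \o S) coact_cleft_antipode.
have -> : c \o (alpha \o k) = conv reg (i \o (alpha \o k)) j.
  rewrite -[RHS](conv_colinear (i \o alpha) j k_colinear) -(tmap_coactE c alpha).
  by apply/funext => h; rewrite /= ca.
by rewrite convA -(convA reg (i \o k \o S)) -(conv_comp _ _ _ (@tenslM K P H)).
Qed.

Lemma twist_cleft_map (alpha : {linear P -> P}) :
  conv c idfun (cleft_map alpha) \o k = alpha \o k.
Proof.
rewrite (conv_colinear idfun _ k_colinear) /cleft_map -convA.
by rewrite conv_hom_antipoder ?conv1g.
Qed.

(** Precomposing with [k] gives (q k) * w = (q k) * w', and q k is convolution invertible. Both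
    injectivity of the correspondence and gluing rest on this. *)
Lemma cleft_cancel (X : ualgType K) (q : {linear P -> X}) (w w' : {linear H -> X}) :
  q \1 = \1 -> {morph q : x y / x ** y} -> conv c q w = conv c q w' -> w =1 w'.
Proof.
move=> q1 qM ww'; have linv : conv reg (q \o k \o S) (q \o k) = cunit X.
  apply: (conv_hom_antipodel (k := q \o k)) => [|x y] /=; first by rewrite k1.
  by rewrite kM qM.
by apply: conv_cancel linv _; rewrite -!(conv_colinear q _ k_colinear) ww'.
Qed.

End Cleft.
End ComoduleAlgebra.
End CovariantMaps.

(** * The opposite Hopf algebra *)

Section AntipodeAntimultiplicative.
Variables (K : fieldType) (H : ualgType K) (hH : hopf H).
Local Notation S := (antipode hH).
Local Notation D := (comul hH).
Local Notation reg := (regular hH).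

Lemma comulM : {morph D : x y / x ** y}.
Proof. by case: (comul_hom hH). Qed.
Lemma comul1 : D \1 = \1.
Proof. by case: (comul_hom hH). Qed.
Lemma counitM x y : counit hH (x ** y) = counit hH x * counit hH y.
Proof. by case: (counit_hom hH). Qed.
Lemma counit1 : counit hH \1 = 1.
Proof. by case: (counit_hom hH). Qed.

Lemma tlift_amul (A B U : ualgType K) (F : A -> B -> U) (s t : tensor A B) : bilin F ->
  tlift F (s ** t) =
    tlift (fun a b => tlift (fun a' b' => F (a ** a') (b ** b')) t) s.
Proof.
move=> bF.
pose L : {linear tensor A B -> U} :=
  HB.pack (tlift F) (GRing.isLinear.Build _ _ _ _ _ (tlift_linear bF)).
rewrite -[LHS]/(L (tensor_mul s t)) linear_tlift; apply: tlift_ext => a b.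
by rewrite linear_tlift; apply: tlift_ext => a' b'; exact: tliftE.
Qed.

(* Antimultiplicativity, one variable at a time: for fixed y the map
   [antipode_conv y] : x |-> \sum y_1 S(x y_2) satisfies
   id * antipode_conv y = epsilon(y) epsilon, hence equals epsilon(y) S; for fixed x
   this says id * S(x _) = epsilon(_) S(x), hence S(x y) = S(y) S(x). *)
Definition antipode_mul (x y : H) : H := S (x ** y).

Lemma antipode_mul_linearl y : linear (antipode_mul^~ y).
Proof. by move=> a x x'; rewrite /antipode_mul amul_linearl linearP. Qed.
Lemma antipode_mul_linearr x : linear (antipode_mul x).
Proof. by move=> a y y'; rewrite /antipode_mul amul_linearr linearP. Qed.

HB.instance Definition _ x :=
  GRing.isLinear.Build K H H *:%R (antipode_mul x) (antipode_mul_linearr x).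

Definition antipode_conv (y x : H) : H := conv reg idfun (antipode_mul x) y.

Lemma antipode_conv_linear y : linear (antipode_conv y).
Proof.
move=> a x x'; rewrite /antipode_conv !convE /= /mulmap -tlift_linear_fun.
by apply: tlift_ext => y1 y2; rewrite [antipode_mul _ _]antipode_mul_linearl amul_linearr.
Qed.
HB.instance Definition _ y :=
  GRing.isLinear.Build K H H *:%R (antipode_conv y) (antipode_conv_linear y).

(** The antipode axiom at [x ** y], expanded by multiplicativity of the comultiplication. *)
Lemma conv_antipode_conv x y :
  conv reg idfun (antipode_conv y) x = (counit hH y * counit hH x) *: \1.
Proof.
rewrite mulrC -counitM -(antipoder hH (x ** y)) comulM tlift_amul; last first.
  exact: (bilin_mul idfun S).
rewrite convE; apply: tlift_ext => x1 x2.
rewrite /antipode_conv convE /= amul_tliftr; apply: tlift_ext => y1 y2.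
by rewrite amulA.
Qed.

Lemma antipode_convE x y : antipode_conv y x = counit hH y *: S x.
Proof.
have -> : antipode_conv y x = conv reg (@cunit K H hH H) (antipode_conv y) x.
  by rewrite conv1g.
rewrite -conv_antipodel convA.
have -> : conv reg idfun (antipode_conv y) =
    ( *:%R (counit hH y)) \o @cunit K H hH H.
  by apply/funext => z; rewrite conv_antipode_conv -scalerA.
have -> : S x = conv reg S (@cunit K H hH H) x by rewrite convu1.
rewrite !convE /= /mulmap linear_tlift.
by apply: tlift_ext => x1 x2; rewrite amulZr.
Qed.

Lemma antipodeM x y : S (x ** y) = S y ** S x.
Proof.
have -> : S (x ** y) = conv reg (@cunit K H hH H) (antipode_mul x) y.
  by rewrite conv1g.
rewrite -conv_antipodel convA.
have -> : conv reg idfun (antipode_mul x) = (fun y => counit hH y *: S x).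
  by apply/funext => z; exact: antipode_convE.
have -> : S y = conv reg S (@cunit K H hH H) y by rewrite convu1.
rewrite !convE /= /mulmap amul_tliftl.
by apply: tlift_ext => y1 y2; rewrite /cunit !amulZr amul1r amulZl.
Qed.

End AntipodeAntimultiplicative.

(** A convertible copy of [A]: linear maps, tensors and coactions are shared with [A], only the
    product is reversed. *)
Definition oppa (K : fieldType) (A : ualgType K) : Type := A.

Section Opposite.
Variables (K : fieldType).

Section Alg.
Variable A : ualgType K.
HB.instance Definition _ := GRing.Lmodule.on (oppa A).
Definition opp_mul (x y : oppa A) : oppa A := (y : A) ** (x : A).
Definition opp_one : oppa A := \1 : A.
Lemma opp_mulA : associative opp_mul.
Proof. by move=> x y z; rewrite /opp_mul amulA. Qed.
Lemma opp_mul1l : left_id opp_one opp_mul.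
Proof. by move=> x; exact: amul1r. Qed.
Lemma opp_mul1r : right_id opp_one opp_mul.
Proof. by move=> x; exact: amul1l. Qed.
HB.instance Definition _ := Lmodule_isUAlgebra.Build K (oppa A)
  opp_mulA opp_mul1l opp_mul1r (@amul_linearr K A) (@amul_linearl K A).
End Alg.

(** Both sides are the same finite double sum over the chosen representatives of [s] and [t]. *)
Lemma tlift_exchange (V W V' W' U : lmodType K) (F : V -> W -> V' -> W' -> U) s t :
  tlift (fun v w => tlift (fun v' w' => F v w v' w') t) s =
  tlift (fun v' w' => tlift (fun v w => F v w v' w') s) t.
Proof.
rewrite /tlift; under eq_bigr do rewrite scaler_sumr.
rewrite exchange_big; apply: eq_bigr => p _; rewrite scaler_sumr.
by apply: eq_bigr => q _; rewrite !scalerA mulrC.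
Qed.

Lemma tensor_mul_op (A B : ualgType K) (s t : tensor A B) :
  @tensor_mul K (oppa A) (oppa B) s t = @tensor_mul K A B t s.
Proof. exact: tlift_exchange. Qed.

Section HopfOpposite.
Variables (H : ualgType K) (hH : hopf H) (Sinv : H -> H).
Hypotheses (SK : cancel (antipode hH) Sinv) (SinvK : cancel Sinv (antipode hH)).

Lemma antipode_inv_linear : linear Sinv.
Proof.
by move=> a x y; apply: (can_inj SK); rewrite SinvK linearP /= !SinvK.
Qed.

Lemma antipode1 : antipode hH \1 = \1.
Proof.
have := antipodel hH \1; rewrite comul1 counit1 scale1r.
by rewrite (tliftE (bilin_mul (antipode hH) idfun)) /= amul1r.
Qed.

(** The injective, antimultiplicative antipode sends the sum to \sum h_1 S(h_2). *)
Lemma antipode_inv_r h : tlift (fun h1 h2 => h2 ** Sinv h1) (comul hH h) = counit hH h *: \1.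
Proof.
apply: (can_inj SK); rewrite linear_tlift linearZ /= antipode1 -(antipoder hH h).
by apply: tlift_ext => h1 h2; rewrite antipodeM SinvK.
Qed.

Lemma antipode_inv_l h : tlift (fun h1 h2 => Sinv h2 ** h1) (comul hH h) = counit hH h *: \1.
Proof.
apply: (can_inj SK); rewrite linear_tlift linearZ /= antipode1 -(antipodel hH h).
by apply: tlift_ext => h1 h2; rewrite antipodeM SinvK.
Qed.

Lemma comul_op_hom : @alg_hom K (oppa H) (tensor (oppa H) (oppa H)) (comul hH).
Proof.
split; [exact: (comul_linear hH)|exact: (comul1 hH)|move=> x y].
apply: etrans (comulM hH y x) _; exact: esym (tensor_mul_op (comul hH x) (comul hH y)).
Qed.

Lemma counit_op_hom :
  [/\ scalar (counit hH : oppa H -> K), counit hH (\1 : oppa H) = 1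
     & {morph (counit hH : oppa H -> K) : x y / x ** y >-> (x * y)%R}].
Proof.
split; [exact: (counit_scalar hH)|exact: (counit1 hH)|move=> x y].
exact: etrans (counitM hH y x) (mulrC _ _).
Qed.

(** In H^op the product of Sinv(h_1) and h_2 is h_2 Sinv(h_1) taken in H, so [antipode_inv_r] serves
    as the left antipode axiom. *)
Definition hopf_op : hopf (oppa H) :=
  @Hopf K (oppa H) (comul hH) (counit hH) Sinv comul_op_hom counit_op_hom
    (comulA hH) (counitl hH) (counitr hH) antipode_inv_linear
    antipode_inv_r antipode_inv_l.

End HopfOpposite.

End Opposite.

(** * Gauge transformations of locally trivial comodule algebras *)

Section LocallyCleft.
Variables (K : fieldType) (H : ualgType K) (hH : hopf H).
Local Notation S := (antipode hH).
Local Notation reg := (regular hH).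
Local Notation cunit A := (@cunit K H hH A).

(** The charts [A i] are abstract comodule algebras cleft by [k i], so that the result applies to a
    bundle and to its opposite alike. *)
Variables (P : ualgType K) (c : comodule hH P).
Hypotheses (c1 : c \1 = \1) (cM : {morph c : x y / x ** y}).

Variables (I : Type) (A : I -> ualgType K) (d : forall i, comodule hH (A i)).
Hypotheses (d1 : forall i, d i \1 = \1) (dM : forall i, {morph d i : x y / x ** y}).

Variable chi : forall i, {linear P -> A i}.
Hypotheses (chi1 : forall i, chi i \1 = \1)
  (chiM : forall i, {morph chi i : x y / x ** y})
  (chi_surj : forall i y, exists f, chi i f = y)
  (chi_colin : forall i, colinear c (d i) (chi i))
  (chi_inj : forall f, (forall i, chi i f = 0) -> f = 0).

(* Q i j stands for P / (ker chi_i + ker chi_j). *)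
Variables (Q : I -> I -> ualgType K) (p : forall i j, {linear P -> Q i j}).
Hypotheses (p1 : forall i j, p i j \1 = \1)
  (pM : forall i j, {morph p i j : x y / x ** y})
  (p_kerl : forall i j f, chi i f = 0 -> p i j f = 0)
  (p_kerr : forall i j f, chi j f = 0 -> p i j f = 0)
  (chi_glue : forall r : I -> P, (forall i j, p i j (r i) = p i j (r j)) ->
    exists f, forall i, chi i f = chi i (r i)).

Variable k : forall i, {linear H -> A i}.
Hypotheses (k1 : forall i, k i \1 = \1) (kM : forall i, {morph k i : x y / x ** y})
  (k_colin : forall i, colinear reg (d i) (k i)).

(* A i stands for B_i ⊗ H, with e a = a ⊗ 1 and k h = 1 ⊗ h; only the products
   e a ** k h enter, so that the opposite algebras are covered as well. *)
Variables (B : I -> Type) (e : forall i, B i -> A i).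
Hypotheses (e1 : forall i, exists b, e b = \1 :> A i)
  (e_coinv : forall i (b : B i) x, d i (e b ** x) = tensl H (e b) ** d i x)
  (e_gen : forall i (f g : {linear A i -> A i}),
    (forall b h, f (e b ** k i h) = g (e b ** k i h)) -> f =1 g).

Variables (T : Type) (iota : T -> P) (pr : forall i, T -> B i).
Hypothesis chi_iota : forall i b, chi i (iota b) = e (pr i b).

Lemma chi_ext f f' : (forall i, chi i f = chi i f') -> f = f'.
Proof.
move=> ff'; apply/eqP; rewrite -subr_eq0; apply/eqP/chi_inj => i.
by rewrite linearB ff' subrr.
Qed.

Lemma trivial_cancel i (X : ualgType K) (q : {linear A i -> X}) (w w' : {linear H -> X}) :
  q \1 = \1 -> {morph q : x y / x ** y} ->
  conv c (q \o chi i) w = conv c (q \o chi i) w' -> w =1 w'.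
Proof.
move=> q1 qM ww'; apply: (cleft_cancel (k1 i) (@kM i) (@k_colin i) q1 qM).
apply/funext => y; have [f <-] := chi_surj y.
have := congr1 (@^~ f) ww'.
by rewrite -!(conv_colinear q _ (@chi_colin i)).
Qed.

(** Composing with [chi i] gives an equation chi_i * w = chi_i * w' in which [chi i] can be
    cancelled, since it is onto the cleft algebra [A i]. *)
Lemma twist_inj (g g' : {linear H -> P}) :
  conv c idfun g = conv c idfun g' -> g =1 g'.
Proof.
move=> gg' h; apply: chi_ext => i.
apply: (@trivial_cancel i (A i) idfun (chi i \o g) (chi i \o g')) => //.
by rewrite -[idfun \o chi i]/(chi i \o idfun) -!(conv_comp _ _ _ (@chiM i)) gg'.
Qed.

Lemma chi_twist i (g : {linear H -> P}) f :
  chi i (conv c idfun g f) = conv (d i) idfun (chi i \o g) (chi i f).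
Proof.
rewrite -[RHS]/((conv (d i) idfun (chi i \o g) \o chi i) f).
rewrite (conv_colinear idfun _ (@chi_colin i)).
by rewrite -[idfun \o chi i]/(chi i \o idfun) -(conv_comp _ _ _ (@chiM i)).
Qed.

Lemma mulmap_tensl (A' : ualgType K) (w : {linear H -> A'}) a t :
  mulmap idfun w (tensl H a ** t) = a ** mulmap idfun w t.
Proof.
move: t; apply: (eq_tensor (f := mulmap idfun w \o amul (tensl H a))
  (g := amul a \o mulmap idfun w)) => x h.
by rewrite /= amul_tens !mulmapE /= amul1l amulA.
Qed.

Lemma twist_e i (w : {linear H -> A i}) (b : B i) x :
  conv (d i) idfun w (e b ** x) = e b ** conv (d i) idfun w x.
Proof. by rewrite convE /= e_coinv mulmap_tensl. Qed.

Lemma twist1 (A' : ualgType K) (c' : comodule hH A') (w : {linear H -> A'}) :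
  c' \1 = \1 -> conv c' idfun w \1 = w \1.
Proof.
by move=> c'1; rewrite convE /= c'1 mulmapE /= amul1l.
Qed.

Lemma tmap_sweedler (X : ualgType K) (f : {linear P -> X}) (g : H -> P) h :
  tmap f id (sweedler3 hH (fun h1 h2 h3 => g h2 ⊗ (S h1 ** h3)) h) =
  sweedler3 hH (fun h1 h2 h3 => f (g h2) ⊗ (S h1 ** h3)) h.
Proof.
rewrite /sweedler3 tmap_tlift; apply: tlift_ext => h1 h'.
rewrite tmap_tlift; apply: tlift_ext => h2 h3.
exact: tmapE f idfun _ _.
Qed.

Lemma chi_covariant i (g : {linear H -> P}) :
  covariant c g -> covariant (d i) (chi i \o g).
Proof.
move=> /covariantP cg; apply/covariantP => h.
by rewrite /= -chi_colin cg tmap_sweedler.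
Qed.

(** Shaped so as to be convertible with [local_left_gauge] when [A i] is B_i ⊗ H, and with
    [local_right_gauge] when it is the opposite algebra. *)
Definition local_gauge_trans i (alpha : A i -> A i) : Prop :=
  [/\ linear alpha, bijective alpha, colinear (d i) (d i) alpha
    & forall b : B i, alpha (e b) = e b] /\
  forall (b : B i) x, alpha (e b ** x) = e b ** alpha x.

Definition gauge_trans (alpha : P -> P) : Prop :=
  [/\ linear alpha, bijective alpha,
      forall b f, alpha (iota b ** f) = iota b ** alpha f
    & exists alpha_ : forall i, A i -> A i, forall i,
        local_gauge_trans (@alpha_ i) /\
        forall f, chi i (alpha f) = alpha_ i (chi i f)].

Definition gauge_map (g : H -> P) : Prop :=
  [/\ linear g, g \1 = \1,
      forall h, c (g h) =
        sweedler3 hH (fun h1 h2 h3 => g h2 ⊗ (S h1 ** h3)) h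
    & exists g' : H -> P, linear g' /\ conv_inverse hH g g'].

Lemma conv_inverseE (g g' : H -> P) : conv_inverse hH g g' <->
  conv reg g g' = cunit P /\ conv reg g' g = cunit P.
Proof.
rewrite !convE; split=> [gg'|[gg' g'g] h].
  by split; apply/funext => h; case: (gg' h).
split; [exact: (congr1 (@^~ h) gg')|exact: (congr1 (@^~ h) g'g)].
Qed.

Lemma conv_inverse_local i (g g' : {linear H -> P}) :
  conv reg g g' = cunit P -> conv reg (chi i \o g) (chi i \o g') = cunit (A i).
Proof. by move=> gg'; rewrite -(conv_comp _ _ _ (@chiM i)) gg' comp_cunit. Qed.

(** The inverse is id * g', by [twistK] in both directions on [P] and on each chart. Linearity over
    the base is checked in the charts, where [e b] is coinvariant. *)
Lemma twist_gauge (g g' : {linear H -> P}) : g \1 = \1 -> covariant c g ->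
  conv reg g g' = cunit P -> conv reg g' g = cunit P ->
  gauge_trans (conv c idfun g).
Proof.
move=> g1 cg gg' g'g; have cg' := covariant_inv c1 cM cg gg' g'g.
split; first exact: linearP.
- by exists (conv c idfun g'); apply: twistK.
- by move=> b f; apply: chi_ext => i; rewrite chi_twist !chiM chi_iota twist_e chi_twist.
exists (fun i => conv (d i) idfun (chi i \o g)) => i; split; last exact: chi_twist.
have cgi := chi_covariant i cg; have cgi' := chi_covariant i cg'.
split; last exact: twist_e.
split; first exact: linearP.
- exists (conv (d i) idfun (chi i \o g')).
    by apply: (twistK (@dM i) cgi); exact: conv_inverse_local.
  by apply: (twistK (@dM i) cgi'); exact: conv_inverse_local.
- exact: (twist_colinear (@dM i) cgi).
(* Writing [e b] as [e b ** \1], the value is [e b ** chi i (g \1)]. *)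
move=> b; rewrite -[e b]amul1r twist_e twist1 ?d1 //=.
by rewrite g1 chi1.
Qed.

Definition linear_map (V W : lmodType K) (f : V -> W) (lf : linear f) :
  {linear V -> W} := HB.pack f (GRing.isLinear.Build K V W *:%R f lf).

(** * Recovering the map from a gauge transformation *)

Section GaugeToMap.
Variables (alpha : P -> P) (alpha_ : forall i, A i -> A i).
Hypothesis alpha_local : forall i, local_gauge_trans (@alpha_ i).
Hypothesis chi_alpha : forall i f, chi i (alpha f) = @alpha_ i (chi i f).

Let a_linear i : linear (@alpha_ i).
Proof. by case: (alpha_local i) => -[]. Qed.
Let a i : {linear A i -> A i} := linear_map (@a_linear i).
Let a_colin i : colinear (d i) (d i) (a i).
Proof. by case: (alpha_local i) => -[]. Qed.
Let g_ i : {linear H -> A i} := conv reg (k i \o S) (a i \o k i).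

(** Both sides commute with left multiplication by [e b] and agree on the image of [k i]; by [e_gen]
    this determines them. *)
Let twist_g_ i : conv (d i) idfun (g_ i) = a i.
Proof.
apply/funext; apply: e_gen => b h.
have [[_ _ _ _] aM] := alpha_local i.
rewrite -[LHS]/(conv (d i) idfun (g_ i) (e b ** k i h)) twist_e [RHS]aM; congr (_ ** _).
exact: (congr1 (@^~ h) (twist_cleft_map (k1 i) (@kM i) (@k_colin i) (a i))).
Qed.

Let g_1 i : g_ i \1 = \1.
Proof.
rewrite -(twist1 (g_ i) (d1 i)) twist_g_; have [b be] := e1 i.
by have [[_ _ _ ae] _] := alpha_local i; rewrite -be; exact: ae.
Qed.

Let lift i (y : A i) : P := sval (cid (chi_surj y)).
Let liftK i (y : A i) : chi i (lift y) = y.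
Proof. exact: svalP (cid (chi_surj y)). Qed.

Section Descent.
Variables (i : I) (X : ualgType K) (q : {linear P -> X}).
Hypotheses (q1 : q \1 = \1) (qM : {morph q : x y / x ** y})
  (q_ker : forall f, chi i f = 0 -> q f = 0).

(** The algebra map through which [q] factors. The section [lift] is arbitrary; its choice is
    immaterial because [q] kills the kernel of [chi i]. *)
Definition descent (y : A i) : X := q (lift y).

Let descentE f : descent (chi i f) = q f.
Proof.
apply/eqP; rewrite -subr_eq0 -linearB; apply/eqP; apply: q_ker.
by rewrite linearB liftK subrr.
Qed.

Let descent_linear : linear descent.
Proof.
move=> b x y; have [f <-] := chi_surj x; have [f' <-] := chi_surj y.
by rewrite -linearP !descentE linearP.
Qed.
Let dq := linear_map descent_linear.

Let descent1 : dq \1 = \1.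
Proof. by rewrite -(chi1 i) [LHS]descentE. Qed.
Let descentM : {morph dq : x y / x ** y}.
Proof.
move=> x y; have [f <-] := chi_surj x; have [f' <-] := chi_surj y.
by rewrite -chiM [LHS]descentE qM; congr (_ ** _); rewrite [RHS]descentE.
Qed.

(** The witness is the image of [g_ i] under the factor map of [q]; the second identity is the image
    of id * g_i = alpha_i. *)
Lemma descent_twist : exists dg : {linear H -> X},
  (forall r h, chi i r = g_ i h -> q r = dg h) /\ conv c q dg = q \o alpha.
Proof.
exists (dq \o g_ i); split=> [r h rh|]; first by rewrite /= -rh [RHS]descentE.
have -> : q = dq \o chi i :> (P -> X) by apply/funext => f; rewrite [RHS]descentE.
rewrite -(conv_comp _ _ _ descentM) -[chi i : P -> A i]/(idfun \o chi i).
rewrite -(conv_colinear idfun (g_ i) (@chi_colin i)) twist_g_.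
by apply/funext => f /=; rewrite chi_alpha.
Qed.

Lemma descent_cancel (w w' : {linear H -> X}) : conv c q w = conv c q w' -> w =1 w'.
Proof.
have qE : q = dq \o chi i :> (P -> X) by apply/funext => f; rewrite [RHS]descentE.
by rewrite qE => /(trivial_cancel descent1 descentM).
Qed.

End Descent.

Lemma glued_map : exists g : {linear H -> P}, forall i, chi i \o g = g_ i.
Proof.
have ex h : exists f, forall i, chi i f = g_ i h.
  have [i j|f fE] := chi_glue (r := fun i => lift (g_ i h)); last first.
    by exists f => i; rewrite fE liftK.
  (* [w] arises by factoring [p i j] through [chi i], [w'] through [chi j]; convolving [p i j] with
     either gives [p i j \o alpha], so they agree. *)
  have [w [wE tw]] := descent_twist (@pM i j) (@p_kerl i j).
  have [w' [w'E tw']] := descent_twist (@pM i j) (@p_kerr i j).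
  rewrite (wE _ h) ?liftK // (w'E _ h) ?liftK //.
  by apply: (descent_cancel (p1 i j) (@pM i j) (@p_kerl i j)); rewrite tw tw'.
have [g gE] := choice ex.
have lg : linear g.
  by move=> b x y; apply: chi_ext => i; rewrite linearP !gE linearP.
by exists (linear_map lg) => i; apply/funext => h; exact: gE.
Qed.

Lemma gauge_map_exists : exists g : {linear H -> P},
  [/\ g \1 = \1, covariant c g & conv c idfun g = alpha].
Proof.
have [g gE] := glued_map.
have g1 : g \1 = \1.
  by apply: chi_ext => i; rewrite chi1 -(g_1 i) -gE.
exists g; split=> //; last first.
  by apply/funext => f; apply: chi_ext => i; rewrite chi_twist gE twist_g_ chi_alpha.
(* Covariance is an equation in [tensor P H], where the maps chi_i ⊗ id are jointly injective, so it
   may be checked in the charts. *)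
apply/covariantP => h; apply: (tmap_jointly_injective chi_inj) => i.
rewrite [RHS](tmap_sweedler (chi i)) [LHS]chi_colin.
have cgi : covariant (d i) (g_ i).
  exact: (cleft_covariant (@d1 i) (@dM i) (k1 i) (@kM i) (@k_colin i) (@a_colin i)).
by have /covariantP := cgi; move/(_ h); rewrite -gE.
Qed.

End GaugeToMap.

Lemma can_linear (V W : lmodType K) (f : V -> W) (f' : W -> V) :
  linear f -> cancel f f' -> cancel f' f -> linear f'.
Proof.
by move=> lf fK f'K b x y; apply: (can_inj fK); rewrite f'K lf !f'K.
Qed.

Lemma colinear_can (X : lmodType K) (c' : comodule hH X) (f f' : {linear X -> X}) :
  cancel f f' -> cancel f' f -> colinear c' c' f -> colinear c' c' f'.
Proof.
move=> fK f'K fc x; rewrite -{1}[x]f'K -fc.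
transitivity (tmap f' idfun (tmap f idfun (c' (f' x)))); first by [].
rewrite [LHS]tlift_tmap; last exact: bilin_tens f' idfun.
by rewrite -[RHS]tmap_id; apply: tlift_ext => v w /=; rewrite fK.
Qed.

Lemma local_gauge_inv i (alpha alpha' : A i -> A i) :
  cancel alpha alpha' -> cancel alpha' alpha ->
  local_gauge_trans alpha -> local_gauge_trans alpha'.
Proof.
move=> aK a'K [[la _ ac ae] aM].
have la' := can_linear la aK a'K.
split; last by move=> b x; apply: (can_inj aK); rewrite a'K aM a'K.
split=> //; first by exists alpha.
  exact: (@colinear_can _ (d i) (linear_map la) (linear_map la') aK a'K ac).
by move=> b; rewrite -{1}[e b]ae aK.
Qed.

(** Lets the inverse transformation have its own map, which will be the required convolution
    inverse. *)
Lemma gauge_inv (alpha alpha' : P -> P) :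
  cancel alpha alpha' -> cancel alpha' alpha ->
  gauge_trans alpha -> gauge_trans alpha'.
Proof.
move=> aK a'K [la _ aM [alpha_ alphaP]].
split; first exact: can_linear la aK a'K.
- by exists alpha.
- by move=> b f; apply: (can_inj aK); rewrite a'K aM a'K.
have ex i : exists f : A i -> A i, cancel (@alpha_ i) f /\ cancel f (@alpha_ i).
  by have [[[_ [f fK f'K] _ _] _] _] := alphaP i; exists f.
exists (fun i => sval (cid (ex i))) => i.
have [bK b'K] := svalP (cid (ex i)); have [aloc chi_a] := alphaP i.
split; first exact: local_gauge_inv bK b'K aloc.
by move=> f; apply: (can_inj bK); rewrite b'K -chi_a a'K.
Qed.

(** Converse of [twistK]: id * (g * g') is the composite, hence equals id = id * epsilon, and
    [twist_inj] applies. *)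
Lemma conv_of_cancel (g g' : {linear H -> P}) : covariant c g ->
  cancel (conv c idfun g) (conv c idfun g') -> conv reg g g' = cunit P.
Proof.
move=> cg K1; apply/funext; apply: twist_inj.
rewrite convu1 -convA; apply/funext => f.
rewrite -[X in conv c X _]/(idfun \o conv c idfun g).
by rewrite -(conv_colinear idfun g' (twist_colinear cM cg)) /= K1.
Qed.

Lemma gauge_mapP (g : H -> P) : gauge_map g -> exists g0 g' : {linear H -> P},
  [/\ g0 = g :> (H -> P), g0 \1 = \1, covariant c g0,
      conv reg g0 g' = cunit P & conv reg g' g0 = cunit P].
Proof.
move=> [lg g1 cg [g' [lg' /conv_inverseE[gg' g'g]]]].
exists (linear_map lg), (linear_map lg'); split=> //.
by apply/covariantP.
Qed.

Theorem gauge_correspondence :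
  set_bij [set g | gauge_map g] [set alpha | gauge_trans alpha] (conv c idfun) /\
  forall g g' : H -> P, gauge_map g -> linear g' -> conv_inverse hH g g' ->
    [/\ gauge_map g', cancel (conv c idfun g) (conv c idfun g')
      & cancel (conv c idfun g') (conv c idfun g)].
Proof.
split; last first.
  move=> g g' [lg g1 cg _] lg' inv_gg'.
  have [gg' g'g] := (conv_inverseE g g').1 inv_gg'.
  pose g0 := linear_map lg; pose g0' := linear_map lg'.
  have cg0 : covariant c g0 by apply/covariantP.
  have cg0' : covariant c g0' := @covariant_inv K H hH P c c1 cM g0 g0' cg0 gg' g'g.
  have K1 := @twistK K H hH P c cM g0 g0' cg0 gg'.
  have K2 := @twistK K H hH P c cM g0' g0 cg0' g'g.
  split; [|exact: K1|exact: K2].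
  split; first exact: lg'; first 1 last.
  - exact: (covariantP c g').1 cg0'.
  - by exists g; split; [exact: lg|apply/conv_inverseE].
  (* Evaluating g * g' = epsilon at the unit gives g(1) g'(1) = 1 with g(1) = 1. *)
  have := congr1 (@^~ \1) gg'; rewrite convE /= comul1.
  rewrite (mulmapE g0 g0') /= g1 amul1l => ->.
  by rewrite -[LHS]/(counit hH \1 *: \1) counit1 scale1r.
split.
- move=> _ /gauge_mapP[g [g' [<- g1 cg gg' g'g]]].
  exact: twist_gauge g1 cg gg' g'g.
- move=> g h; rewrite !inE => /gauge_mapP[g0 [_ [<- _ _ _ _]]].
  move=> /gauge_mapP[h0 [_ [<- _ _ _ _]]] gh.
  by apply/funext; exact: twist_inj gh.
move=> alpha /= ga.
have [la [alpha' aK a'K] _ [alpha_ alphaP]] := ga.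
have [_ _ _ [alpha'_ alpha'P]] := gauge_inv aK a'K ga.
(* [g] is obtained from [alpha] and [g'] from its inverse; as the twists cancel, the maps are
   convolution inverse. *)
have [g [g1 cg ga1]] := gauge_map_exists (fun i => (alphaP i).1) (fun i => (alphaP i).2).
have [g' [_ cg' ga']] := gauge_map_exists (fun i => (alpha'P i).1) (fun i => (alpha'P i).2).
exists g; last exact: ga1.
split; [exact: linearP|exact: g1|exact/covariantP|].
exists g'; split; first exact: linearP.
apply/conv_inverseE; split; apply: conv_of_cancel => //; by rewrite ga1 ga'.
Qed.

End LocallyCleft.

(** * Bundles *)

Section QuotientComodule.
Variables (K : fieldType) (H : ualgType K) (hH : hopf H).
Local Notation D := (comul hH).

Lemma tmap_tassoc (V V' W U : lmodType K) (f : {linear V -> V'})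
    (t : tensor V (tensor W U)) :
  tmap (tmap f id) id (tassoc t) = tassoc (tmap f id t).
Proof.
move: t; apply: (eq_tensor3 (f := tmap (tmap f idfun) idfun \o @tassoc K V W U)
  (g := @tassoc K V' W U \o tmap f idfun)) => v w u.
rewrite /= (tmapE f idfun v (w ⊗ u)) !tassocE.
by rewrite (tmapE (tmap f idfun) idfun (v ⊗ w) u) /= (tmapE f idfun v w).
Qed.

Lemma tmap_comp (V V' V'' W W' W'' : lmodType K) (f : {linear V -> V'})
    (f' : {linear V' -> V''}) (g : {linear W -> W'}) (g' : {linear W' -> W''}) t :
  tmap f' g' (tmap f g t) = tmap (f' \o f) (g' \o g) t.
Proof. exact: tlift_tmap (bilin_tens f' g'). Qed.

Variables (X Y : lmodType K) (c : comodule hH X) (f : {linear X -> Y}).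
Variable d : {linear Y -> tensor Y H}.
Hypotheses (f_surj : forall y, exists x, f x = y)
  (df : forall x, tmap f id (c x) = d (f x)).

(* Coassociativity on Y is inherited from X along the surjective colinear f; with
   f = chi_i it gives the trivial coaction without computing in triple tensors. *)
Lemma quotient_coactA y : tmap d id (d y) = tassoc (tmap id D (d y)).
Proof.
have [x <-] := f_surj y; rewrite -df.
rewrite [LHS](tmap_comp f d idfun idfun).
have -> : d \o f = tmap f id \o c by apply/funext => z; rewrite /= df.
rewrite [RHS](congr1 _ (tmap_comp f idfun idfun D _)).
transitivity (tassoc (tmap f idfun (tmap idfun D (c x)))); last first.
  by rewrite [in LHS](tmap_comp idfun f D idfun).
rewrite -tmap_tassoc -[tassoc _](coactA c).
by rewrite [RHS](tmap_comp c (tmap f idfun) idfun idfun).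
Qed.

Lemma quotient_counit y : tlift (fun y0 y1 => counit hH y1 *: y0) (d y) = y.
Proof.
have [x <-] := f_surj y; rewrite -df.
rewrite [LHS](tlift_tmap f idfun _ (bilin_contract Y (counit hH))).
rewrite -[x in RHS](coact_counit c) linear_tlift; apply: tlift_ext => x0 x1.
by rewrite linearZ.
Qed.

Definition quotient_comodule : comodule hH Y :=
  Comodule (linearP d) quotient_coactA quotient_counit.

End QuotientComodule.

(** * Local trivializations as cleft charts *)

Section TrivialFamily.
Variables (K : fieldType) (H : ualgType K) (hH : hopf H).
Local Notation D := (comul hH).

Lemma tmapM (A A' B : ualgType K) (f : {linear A -> A'}) :
  {morph f : x y / x ** y} ->
  forall s t : tensor A B, tmap f id (s ** t) = tmap f id s ** tmap f id t.
Proof.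
move=> fM s t; move: s.
apply: (eq_tensor (f := tmap f idfun \o amulr t)
  (g := amulr (tmap f idfun t) \o tmap f idfun)) => a b.
move: t; apply: (eq_tensor (f := tmap f idfun \o amul (a ⊗ b))
  (g := amul (tmap f idfun (a ⊗ b)) \o tmap f idfun)) => a' b'.
rewrite /= amul_tens !(tmapE f idfun) /= fM.
exact: esym (amul_tens _ _ _ _).
Qed.

Lemma trivial_coaction_linear (A : ualgType K) : linear (@trivial_coaction K H hH A).
Proof. exact: linearP (@tassoc K A H H \o tmap idfun D). Qed.

Lemma trivial_coaction_tens (A : ualgType K) (a : A) h :
  trivial_coaction hH (a ⊗ h) = tmap (tens a) id (D h).
Proof.
rewrite /trivial_coaction (tmapE idfun D a h).
exact: tliftE (@bilin_tassoc K A H H) a (D h).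
Qed.

Variables (I : finType) (P : ualgType K) (c : comodule hH P).
Hypotheses (c1 : c \1 = \1) (cM : {morph c : x y / x ** y}).

Variables (A : I -> ualgType K) (chi : forall i, {linear P -> tensor (A i) H}).
Hypotheses (chi_hom : forall i, alg_hom (chi i))
  (chi_surj : forall i y, exists f, chi i f = y)
  (chi_colin : forall i f, tmap (chi i) id (c f) = trivial_coaction hH (chi i f))
  (chi_complete : complete_covering (fun i => ker_ideal (chi_hom i))).
Variables (T : Type) (iota : T -> P) (pr : forall i, T -> A i).
Hypothesis chi_iota : forall i b, chi i (iota b) = pr i b ⊗ \1.

Definition trivial_map (A0 : ualgType K) : {linear tensor A0 H -> tensor (tensor A0 H) H} :=
  linear_map (@trivial_coaction_linear A0).

Definition trivial_comodule i : comodule hH (tensor (A i) H) :=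
  quotient_comodule (c := c) (d := trivial_map (A i)) (@chi_surj i) (@chi_colin i).

Lemma trivial_comodule_tens i a h :
  trivial_comodule i (a ⊗ h) = tmap (tens a) id (D h).
Proof. exact: trivial_coaction_tens. Qed.

Lemma chiM i : {morph chi i : x y / x ** y}. Proof. by case: (chi_hom i). Qed.
Lemma chi1 i : chi i \1 = \1. Proof. by case: (chi_hom i). Qed.

Lemma trivial_comodule_chi i f : trivial_comodule i (chi i f) = tmap (chi i) id (c f).
Proof. exact: esym (chi_colin _ _). Qed.

Lemma trivial_comodule1 i : trivial_comodule i \1 = \1.
Proof.
rewrite -(chi1 i) trivial_comodule_chi c1.
by apply: etrans (tmapE (chi i) idfun \1 \1) _; rewrite chi1.
Qed.

(** Multiplicativity is transported from [c] along the surjective algebra map [chi i]. *)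
Lemma trivial_comoduleM i : {morph trivial_comodule i : x y / x ** y}.
Proof.
move=> x y; have [f <-] := chi_surj x; have [f' <-] := chi_surj y.
rewrite -chiM !trivial_comodule_chi cM; exact: tmapM (@chiM i) _ _.
Qed.

Lemma trivial_comodule_base i (a : A i) :
  trivial_comodule i (tensl H a) = tensl H (tensl H a).
Proof.
rewrite trivial_comodule_tens comul1.
exact: tmapE (linear_map ((tens_bilin (A i) H).2 a)) idfun \1 \1.
Qed.

Lemma trivial_comodule_tensl i (a : A i) x :
  trivial_comodule i (tensl H a ** x) = tensl H (tensl H a) ** trivial_comodule i x.
Proof. by rewrite trivial_comoduleM trivial_comodule_base. Qed.

Lemma tensr_colinear i : colinear (regular hH) (trivial_comodule i) (@tensr K (A i) H).
Proof. by move=> h; rewrite [RHS]trivial_comodule_tens. Qed.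

Lemma chi_injective f : (forall i, chi i f = 0) -> f = 0.
Proof. exact: chi_complete.1. Qed.

Definition overlap i j := ideal_sum (ker_ideal (chi_hom i)) (ker_ideal (chi_hom j)).

Definition overlap_proj i j : {linear P -> quota (overlap i j)} :=
  linear_map (@qpi_linear K P (overlap i j)).

Lemma overlap_projM i j : {morph overlap_proj i j : x y / x ** y}.
Proof. by move=> x y; apply: esym; exact: qpi_mul. Qed.

Lemma overlap_projP i j f g : overlap i j (f - g) -> overlap_proj i j f = overlap_proj i j g.
Proof. by move=> fg; apply/qpiP. Qed.

Lemma overlap_proj_kerl i j f : chi i f = 0 -> overlap_proj i j f = 0.
Proof.
move=> f0; rewrite -(linear0 (overlap_proj i j)); apply: overlap_projP.
by rewrite subr0; exists f, 0; rewrite addr0; split=> //; exact: linear0.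
Qed.

Lemma overlap_proj_kerr i j f : chi j f = 0 -> overlap_proj i j f = 0.
Proof.
move=> f0; rewrite -(linear0 (overlap_proj i j)); apply: overlap_projP.
by rewrite subr0; exists 0, f; rewrite add0r; split=> //; exact: linear0.
Qed.

(** Completeness speaks of classes modulo ker chi_i and of their representatives; replacing [r i] by
    the representative of its class changes neither its image under [chi i] nor those in the
    overlaps. *)
Lemma chi_glue (r : I -> P) :
  (forall i j, overlap_proj i j (r i) = overlap_proj i j (r j)) ->
  exists f, forall i, chi i f = chi i (r i).
Proof.
move=> rr; pose a i := aproj (ker_ideal (chi_hom i)) (r i).
have aE i : chi i (qrepr (a i) - r i) = 0.
  have : ker_ideal (chi_hom i) (qrepr (a i) - r i) by apply/qpiP; rewrite qreprK.
  by [].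
have [i j|f fE] := chi_complete.2 a.
  have li : overlap_proj i j (qrepr (a i)) = overlap_proj i j (r i).
    apply/eqP; rewrite -subr_eq0 -linearB; apply/eqP; exact: overlap_proj_kerl.
  have lj : overlap_proj i j (qrepr (a j)) = overlap_proj i j (r j).
    apply/eqP; rewrite -subr_eq0 -linearB; apply/eqP; exact: overlap_proj_kerr.
  exact: etrans li (etrans (rr i j) (esym lj)).
exists f => i; apply/eqP; rewrite -subr_eq0 -linearB; apply/eqP.
by have /qpiP := fE i.
Qed.

Lemma tens_ext i (f g : {linear tensor (A i) H -> tensor (A i) H}) :
  (forall a h, f (tensl H a ** tensr (A i) h) = g (tensl H a ** tensr (A i) h)) -> f =1 g.
Proof. by move=> fg; apply: eq_tensor => a h; rewrite !tens_lr. Qed.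

Theorem left_correspondence :
  set_bij [set g | gauge_map c g]
    [set alpha | gauge_trans trivial_comodule chi (fun i => tensl H (A := A i)) iota alpha]
    (conv c idfun) /\
  forall g g' : H -> P, gauge_map c g -> linear g' -> conv_inverse hH g g' ->
    [/\ gauge_map c g', cancel (conv c idfun g) (conv c idfun g')
      & cancel (conv c idfun g') (conv c idfun g)].
Proof.
(* The [erefl] arguments are unit conditions: the unit of a quotient is the class of [\1], that of a
   tensor product is [\1 ⊗ \1]. *)
exact: (gauge_correspondence c1 cM trivial_comodule1
  trivial_comoduleM chi1 chiM chi_surj (fun i f => esym (trivial_comodule_chi i f))
  chi_injective (fun i j => erefl (overlap_proj i j \1)) overlap_projM
  overlap_proj_kerl overlap_proj_kerr chi_glue
  (fun i => erefl (tensr (A i) (\1 : H))) (fun i => @tensrM K (A i) H) tensr_colinear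
  (fun i => ex_intro _ \1 (erefl (\1 : tensor (A i) H)))
  trivial_comodule_tensl tens_ext chi_iota).
Qed.

End TrivialFamily.

(** * Right gauge transformations through opposite algebras *)

Section RightBundle.
Variables (K : fieldType) (H : ualgType K) (hH : hopf H) (Sinv : H -> H).
Hypotheses (SK : cancel (antipode hH) Sinv) (SinvK : cancel Sinv (antipode hH)).
Local Notation hop := (hopf_op SK SinvK).

Definition comodule_op (X : ualgType K) (c : comodule hH X) : comodule hop (oppa X) :=
  @Comodule K (oppa H) hop (oppa X) c (coact_linear c) (coactA c) (coact_counit c).

Lemma comodule_op1 (X : ualgType K) (c : comodule hH X) : c \1 = \1 ->
  comodule_op c \1 = \1.
Proof. by []. Qed.

Lemma comodule_opM (X : ualgType K) (c : comodule hH X) : {morph c : x y / x ** y} ->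
  {morph comodule_op c : x y / x ** y}.
Proof.
move=> cM x y; apply: etrans (cM y x) _.
exact: esym (tensor_mul_op (c x) (c y)).
Qed.

Definition op_map (X Y : ualgType K) (f : {linear X -> Y}) :
    {linear oppa X -> oppa Y} :=
  @linear_map K (oppa X) (oppa Y) f (linearP f).

Lemma op_mapM (X Y : ualgType K) (f : {linear X -> Y}) :
  {morph f : x y / x ** y} -> {morph op_map f : x y / x ** y}.
Proof. by move=> fM x y; exact: fM. Qed.

Variables (I : finType) (P : ualgType K) (c : comodule hH P).
Hypotheses (c1 : c \1 = \1) (cM : {morph c : x y / x ** y}).

Variables (A : I -> ualgType K) (chi : forall i, {linear P -> tensor (A i) H}).
Hypotheses (chi_hom : forall i, alg_hom (chi i))
  (chi_surj : forall i y, exists f, chi i f = y)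
  (chi_colin : forall i f, tmap (chi i) id (c f) = trivial_coaction hH (chi i f))
  (chi_complete : complete_covering (fun i => ker_ideal (chi_hom i))).
Variables (T : Type) (iota : T -> P) (pr : forall i, T -> A i).
Hypothesis chi_iota : forall i b, chi i (iota b) = pr i b ⊗ \1.

Local Notation d := (trivial_comodule chi_surj chi_colin).
Local Notation O i := (oppa (tensor (A i) H)).

Let d_op i : comodule hop (O i) := comodule_op (d i).
Let chi_op i : {linear oppa P -> O i} := op_map (chi i).
Let k_op i : {linear oppa H -> O i} := op_map (@tensr K (A i) H).
Let p_op i j : {linear oppa P -> oppa (quota (overlap chi_hom i j))} :=
  op_map (overlap_proj chi_hom i j).

Lemma k_op_colinear i : colinear (regular hop) (d_op i) (k_op i).
Proof. move=> h; exact: tensr_colinear. Qed.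

Let e_op i (a : A i) : O i := tensl H a.

Lemma e_op_coinv i (b : A i) (x : O i) :
  d_op i (e_op b ** x) = tensl (oppa H) (e_op b) ** d_op i x.
Proof.
rewrite (comodule_opM (trivial_comoduleM cM chi_hom chi_surj chi_colin (i := i))).
have E : d_op i (e_op b) = tensl (oppa H) (e_op b).
  (* The type ascriptions return from the opposite algebras to [A i] and [H], where the coinvariance
     of a ⊗ 1 is already known. *)
  have l : d_op i (e_op b) = d i (tensl H b) :> tensor (tensor (A i) H) H by [].
  have r : tensl (oppa H) (e_op b) = tensl H (tensl H b)
      :> tensor (tensor (A i) H) H by [].
  exact: etrans l (etrans (trivial_comodule_base chi_surj chi_colin b) (esym r)).
by rewrite -E.
Qed.

(** Since a ⊗ 1 and 1 ⊗ h commute, a ⊗ h is their product in the opposite algebra too. *)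
Lemma tens_op_ext i (f g : {linear O i -> O i}) :
  (forall a h, f (e_op a ** k_op i h) = g (e_op a ** k_op i h)) -> f =1 g.
Proof.
move=> fg; apply: tensor_linear_ext; [exact: (linearP f)|exact: (linearP g)|].
move=> a h; have E : a ⊗ h = e_op a ** k_op i h :> O i.
  by apply: etrans (esym (amul_tens _ _ _ _)); rewrite amul1l amul1r.
by have := fg a h; rewrite -E.
Qed.

Theorem right_correspondence :
  set_bij [set g | gauge_map (comodule_op c) g]
    [set alpha | gauge_trans d_op chi_op e_op (iota : T -> oppa P) alpha]
    (conv (comodule_op c) idfun) /\
  forall g g' : oppa H -> oppa P,
    gauge_map (comodule_op c) g -> linear g' -> conv_inverse hop g g' ->
    [/\ gauge_map (comodule_op c) g',
        cancel (conv (comodule_op c) idfun g) (conv (comodule_op c) idfun g')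
      & cancel (conv (comodule_op c) idfun g') (conv (comodule_op c) idfun g)].
Proof.
exact: (@gauge_correspondence K (oppa H) hop (oppa P)
  (comodule_op c) (comodule_op1 c1) (comodule_opM cM) I (fun i => O i) d_op
  (fun i => comodule_op1 (trivial_comodule1 c1 chi_hom chi_surj chi_colin i))
  (fun i => comodule_opM (@trivial_comoduleM K H hH I P c cM A chi chi_hom chi_surj chi_colin i))
  chi_op
  (fun i => chi1 chi_hom i) (fun i => op_mapM (@chiM K H I P A chi chi_hom i))
  chi_surj (fun i f => chi_colin i f) (chi_injective chi_complete)
  (fun i j => oppa (quota (overlap chi_hom i j))) p_op
  (fun i j => erefl) (fun i j => op_mapM (@overlap_projM K H I P A chi chi_hom i j))
  (@overlap_proj_kerl K H I P A chi chi_hom) (@overlap_proj_kerr K H I P A chi chi_hom)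
  (chi_glue chi_complete) k_op (fun i => erefl)
  (fun i => op_mapM (@tensrM K (A i) H)) k_op_colinear A e_op
  (fun i => ex_intro _ \1 (erefl (\1 : tensor (A i) H)))
  e_op_coinv tens_op_ext T iota pr chi_iota).
Qed.

End RightBundle.

(** * The two correspondences for a bundle *)

Section Bundle.
Variables (K : fieldType) (H : ualgType K) (hH : hopf H).
Variables (I : finType) (B P : ualgType K) (E : qpfb hH I B P).

Lemma coaction_hom : alg_hom (coaction E).
Proof. by case: (coaction_comodule E). Qed.

Lemma coaction_linear : linear (coaction E). Proof. by case: coaction_hom. Qed.
Lemma coaction1 : coaction E \1 = \1. Proof. by case: coaction_hom. Qed.
Lemma coactionM : {morph coaction E : x y / x ** y}.
Proof. by case: coaction_hom. Qed.
Lemma coactionA f : tmap (coaction E) id (coaction E f) =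
  tassoc (tmap id (comul hH) (coaction E f)).
Proof. by case: (coaction_comodule E). Qed.
Lemma coaction_counit f : tlift (fun f0 f1 => counit hH f1 *: f0) (coaction E f) = f.
Proof. by case: (coaction_comodule E). Qed.

Definition bundle_comodule : comodule hH P :=
  Comodule coaction_linear coactionA coaction_counit.

Lemma chi_linear i : linear (@chi K H hH I B P E i).
Proof. by case: (chi_hom E i). Qed.

Definition base_algebra i : ualgType K := quota (base_ideal E i).

Definition chi_map i : {linear P -> tensor (base_algebra i) H} :=
  linear_map (@chi_linear i).

Lemma left_gaugeP :
  set_bij [set g | left_gauge_map E g] [set alpha | left_gauge E alpha]
     (left_gauge_of E) /\
   forall g g' : H -> P,
     left_gauge_map E g -> linear g' -> conv_inverse hH g g' ->
     [/\ left_gauge_map E g',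
         cancel (left_gauge_of E g) (left_gauge_of E g')
       & cancel (left_gauge_of E g') (left_gauge_of E g)].
Proof.
have tw : conv bundle_comodule idfun = left_gauge_of E.
  by apply/funext => g; rewrite convE.
have := @left_correspondence K H hH I P bundle_comodule coaction1 coactionM base_algebra
  chi_map (chi_hom E) (chi_surj (q := E)) (@chi_colinear K H hH I B P E) (chi_complete E)
  B (Defs.iota E) (fun i => aproj (base_ideal E i)) (@chi_iota K H hH I B P E);
  rewrite tw => -[bij inv].
split; [exact: bij|exact: inv].
Qed.

Variables (Sinv : H -> H).
Hypotheses (SK : cancel (antipode hH) Sinv) (SinvK : cancel Sinv (antipode hH)).

(** Reversing the products exchanges the two identities. *)
Lemma conv_inverse_opE (g g' : H -> P) :
  @conv_inverse K (oppa H) (hopf_op SK SinvK) (oppa P) g g' <-> conv_inverse_op hH g g'.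
Proof. by split=> gg' h; case: (gg' h). Qed.

(** The covariance conditions agree by conversion, [Sinv] being the antipode of H^op; only the
    inverse has to be translated. *)
Lemma right_gauge_mapE (g : H -> P) :
  gauge_map (comodule_op SK SinvK bundle_comodule) g <-> right_gauge_map E Sinv g.
Proof.
split=> -[lg g1 cg [g' [lg' gg']]]; split; [exact: lg|exact: g1|exact: cg|
  |exact: lg|exact: g1|exact: cg|]; exists g'; split; try exact: lg';
  exact/conv_inverse_opE.
Qed.

Lemma right_gaugeP :
   set_bij [set g | right_gauge_map E Sinv g] [set alpha | right_gauge E alpha]
     (right_gauge_of E) /\
   forall g g' : H -> P,
     right_gauge_map E Sinv g -> linear g' -> conv_inverse_op hH g g' ->
     [/\ right_gauge_map E Sinv g',
         cancel (right_gauge_of E g) (right_gauge_of E g')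
       & cancel (right_gauge_of E g') (right_gauge_of E g)].
Proof.
have tw : conv (comodule_op SK SinvK bundle_comodule) idfun = right_gauge_of E.
  by apply/funext => g; rewrite convE.
have := @right_correspondence K H hH Sinv SK SinvK I P bundle_comodule coaction1 coactionM base_algebra
  chi_map (chi_hom E) (chi_surj (q := E)) (@chi_colinear K H hH I B P E) (chi_complete E)
  B (Defs.iota E) (fun i => aproj (base_ideal E i)) (@chi_iota K H hH I B P E);
  rewrite tw => -[bij inv].
split.
  have -> : [set g | right_gauge_map E Sinv g] =
      [set g | gauge_map (comodule_op SK SinvK bundle_comodule) g].
    by apply/seteqP; split=> g /right_gauge_mapE.
  exact: bij.
move=> g g' /right_gauge_mapE hg lg' /conv_inverse_opE gg'.
have [/right_gauge_mapE hg' K1 K2] := inv g g' hg lg' gg'.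
by split; [exact: hg'|exact: K1|exact: K2].
Qed.
End Bundle.

Theorem proposition4 (R : realType) (I : finType) (B P H : ualgType R[i])
    (hH : hopf H) (E : qpfb hH I B P) (Sinv : H -> H)
    (SK : cancel (antipode hH) Sinv) (SinvK : cancel Sinv (antipode hH)) :
  (set_bij [set g | left_gauge_map E g] [set alpha | left_gauge E alpha]
     (left_gauge_of E) /\
   forall g g' : H -> P,
     left_gauge_map E g -> linear g' -> conv_inverse hH g g' ->
     [/\ left_gauge_map E g',
         cancel (left_gauge_of E g) (left_gauge_of E g')
       & cancel (left_gauge_of E g') (left_gauge_of E g)]) /\
  (set_bij [set g | right_gauge_map E Sinv g] [set alpha | right_gauge E alpha]
     (right_gauge_of E) /\
   forall g g' : H -> P,
     right_gauge_map E Sinv g -> linear g' -> conv_inverse_op hH g g' ->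
     [/\ right_gauge_map E Sinv g',
         cancel (right_gauge_of E g) (right_gauge_of E g')
       & cancel (right_gauge_of E g') (right_gauge_of E g)]).
Proof.
by split; [exact: left_gaugeP|exact: right_gaugeP SK SinvK].
Qed.
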